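(* Let $x:M^2\to\mathbb{C}^2$ be a self-shrinker with constant Kähler angle $\theta\in(0,\pi)$. If $M$ is compact and orientable, then the Maslov class $[\alpha]\in H^1(M)$ of $x$ satisfies $[\alpha]\neq0$.
   Context: $\mathbb{C}^2$ has coordinates $z_k=x_k+\sqrt{-1}\,y_k$ ($k=1,2$), the Euclidean metric $\langle\cdot,\cdot\rangle$, the canonical complex structure $\mathbf{J}\frac{\partial}{\partial x_k}=\frac{\partial}{\partial y_k}$, $\mathbf{J}\frac{\partial}{\partial y_k}=-\frac{\partial}{\partial x_k}$, and the Kähler form $\omega$ determined by $\langle U,V\rangle=\omega(U,\mathbf{J}V)$. Let $x:M^2\to\mathbb{C}^2$ be a smooth immersion of an oriented surface (without boundary), with induced metric and volume form $dV_M$. The Kähler angle $\theta:M\to[0,\pi]$ of $x$ is defined by $x^*\omega=\cos\theta\, dV_M$; equivalently $\cos\theta=\langle\mathbf{J}(x_*e_1),x_*e_2\rangle$ for any oriented orthonormal tangent frame $\{e_1,e_2\}$. The mean curvature vector is the trace of the second fundamental form $h$: $H=h(e_1,e_1)+h(e_2,e_2)$. The immersion $x$ is a self-shrinker if $H=-x^\perp$, where $^\perp$ is the orthogonal projection of the position vector to the normal bundle of $x$. Let $\Omega=dz_1\wedge dz_2$ and let $\eta_x$ be the complex-valued function on $M$ with $x^*\Omega=\eta_x\,dV_M$. If $\theta\in(0,\pi)$ everywhere then $\eta_x$ is nowhere zero, and the Lagrangian angle $\beta_x:M\to\mathbb{R}/2\pi\mathbb{Z}$ is defined by $\eta_x=|\eta_x|e^{\sqrt{-1}\beta_x}$.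 The Maslov form $\alpha:=-d\beta_x$ is a well-defined closed $1$-form on $M$, and its de Rham class $[\alpha]\in H^1(M)$ is the Maslov class of $x$. *)

(* Defs.v *)
From HB Require Import structures.
From mathcomp Require Import all_boot all_order all_algebra.
From mathcomp Require Import complex.
From mathcomp Require Import all_classical all_reals all_analysis.
Set Implicit Arguments. Unset Strict Implicit. Unset Printing Implicit Defensive.
Import Order.TTheory GRing.Theory Num.Theory.
Import numFieldNormedType.Exports.
Local Open Scope classical_set_scope.
Local Open Scope ring_scope.

Section PlaneCalculus.
Context {R : realType}.

Definition partial {W : normedModType R} (k : 'I_2) (f : 'rV[R]_2 -> W)
  : 'rV[R]_2 -> W := fun p => 'D_('e_k) f p.

(* C^oo on the open set U: every iterated partial derivative exists and is
   continuous at every point of U. *)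
Definition smooth_on {W : normedModType R} (U : set 'rV[R]_2)
    (f : 'rV[R]_2 -> W) : Prop :=
  forall (s : seq 'I_2) (p : 'rV[R]_2), U p ->
    {for p, continuous (foldr partial f s)} /\
    forall k, derivable (foldr partial f s) p 'e_k.

(* A 1-form a_0 du_0 + a_1 du_1 on the plane is the column of its
   coefficients. *)
Definition differential (f : 'rV[R]_2 -> R) (p : 'rV[R]_2) : 'cV[R]_2 :=
  \col_k partial (W := R^o) k f p.

Lemma sum_delta_rV2 {V : lmodType R} (Z : 'I_2 -> 'I_2 -> V) a b :
  Z a b = \sum_i \sum_j (('e_a : 'rV[R]_2) 0 i * ('e_b : 'rV[R]_2) 0 j) *: Z i j.
Proof.
rewrite (bigD1 a) //= (bigD1 b) //= !mxE !eqxx mulr1 scale1r.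
rewrite big1 ?addr0 => [|j /negPf jb]; last by rewrite !mxE jb andbF mulr0 scale0r.
rewrite big1 ?addr0 // => i /negPf ia; rewrite big1 // => j _.
by rewrite !mxE ia andbF mul0r scale0r.
Qed.

End PlaneCalculus.

(* A surface with an oriented smooth atlas. The local coordinates [chart i] and
   the parametrization [param i] are total functions, meaningful only on the
   open sets [chart_dom i] and [chart_cod i]. Connectedness is not required. *)
Record oriented_surface (R : realType) := OrientedSurface {
  carrier :> topologicalType;
  surface_hausdorff : hausdorff_space carrier;
  surface_second_countable : @second_countable carrier;
  surface_nonempty : [set: carrier] !=set0;
  chart_index : Type;
  chart_dom : chart_index -> set carrier;
  chart_cod : chart_index -> set 'rV[R]_2;
  chart : chart_index -> carrier -> 'rV[R]_2;
  param : chart_index -> 'rV[R]_2 -> carrier;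
  chart_dom_open : forall i, open (chart_dom i);
  chart_cod_open : forall i, open (chart_cod i);
  chart_cover : forall m, exists i, chart_dom i m;
  chart_dom_cod : forall i m, chart_dom i m -> chart_cod i (chart i m);
  param_cod_dom : forall i p, chart_cod i p -> chart_dom i (param i p);
  chartK : forall i m, chart_dom i m -> param i (chart i m) = m;
  paramK : forall i p, chart_cod i p -> chart i (param i p) = p;
  chart_continuous : forall i, {within chart_dom i, continuous (chart i)};
  param_continuous : forall i, {within chart_cod i, continuous (param i)};
  transition_smooth : forall i j,
    smooth_on (chart_cod i `&` param i @^-1` chart_dom j) (chart j \o param i);
  transition_oriented : forall i j p,
    chart_cod i p -> chart_dom j (param i p) ->
    0 < \det ('J (chart j \o param i) p)
}.

Section ComplexPlane.
Context {R : realType}.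

(* Row k of a vector holds the two real coordinates (x_k, y_k) of z_k. *)
Definition C2 : normedModType R := 'M[R]_(2, 2).

Definition zcoord (k : 'I_2) (U : C2) : R[i] := (U k 0 +i* U k 1)%C.

Definition metric (U V : C2) : R := \sum_k \sum_c U k c * V k c.

Definition Jstr (U : C2) : C2 :=
  \matrix_(k, c) (if c == 0 then - U k 1 else U k 0).

Definition kahler_form (U V : C2) : R := metric (Jstr U) V.

Lemma kahler_formP (U V : C2) : metric U V = kahler_form U (Jstr V).
Proof.
rewrite /kahler_form /metric; apply: eq_bigr => k _.
by rewrite !big_ord_recl !big_ord0 !mxE /= mulrNN !addr0 addrC; congr (_ * _ + _ * _);
  congr (_ k _); apply/val_inj.
Qed.

(* dz_1 /\ dz_2 *)
Definition holomorphic_volume (U V : C2) : R[i] :=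
  zcoord 0 U * zcoord 1 V - zcoord 0 V * zcoord 1 U.

End ComplexPlane.
Arguments C2 : clear implicits.

(* Geometry of an immersion, read in an oriented parametrization
   y = x \o param i at the coordinate point p. *)
Section ParametrizedSurface.
Context {R : realType}.
Variables (y : 'rV[R]_2 -> C2 R) (p : 'rV[R]_2).

Definition immersive : Prop :=
  forall u : 'rV[R]_2, \sum_a u 0 a *: partial a y p = 0 -> u = 0.

Definition gram : 'M[R]_2 :=
  \matrix_(a, b) metric (partial a y p) (partial b y p).

(* dV_M = area_density du_0 /\ du_1 *)
Definition area_density : R := Num.sqrt (\det gram).

Definition tangent_part (V : C2 R) : C2 R :=
  \sum_a \sum_b (invmx gram a b * metric V (partial a y p)) *: partial b y p.

Definition normal_part (V : C2 R) : C2 R := V - tangent_part V.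

(* Tangent vectors are given by their components in the basis (d_0 y, d_1 y). *)
Definition second_fundamental_form (u v : 'rV[R]_2) : C2 R :=
  normal_part (\sum_a \sum_b (u 0 a * v 0 b) *: partial a (partial b y) p).

Definition mean_curvature : C2 R :=
  \sum_a \sum_b invmx gram a b *: second_fundamental_form 'e_a 'e_b.

Definition kahler_angle : R :=
  acos (kahler_form (partial 0 y p) (partial 1 y p) / area_density).

Definition eta : R[i] :=
  holomorphic_volume (partial 0 y p) (partial 1 y p) / (area_density%:C)%C.

(* The Lagrangian angle, an element of R / 2 pi Z, is the coset of its real
   representatives. *)
Definition lagrangian_angle : set R :=
  [set b | eta = `|eta| * (cos b +i* sin b)%C].

End ParametrizedSurface.

Section MeanCurvatureFrame.
Context {R : realType}.
Variables (y : 'rV[R]_2 -> C2 R) (p : 'rV[R]_2).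

Lemma normal_part_linear : linear (normal_part y p).
Proof.
move=> c U V; rewrite /normal_part scalerBr addrACA -opprD; congr (_ - _).
rewrite /tangent_part scaler_sumr -big_split; apply: eq_bigr => a _ /=.
rewrite scaler_sumr -big_split; apply: eq_bigr => b _ /=.
rewrite scalerA -scalerDl; congr (_ *: _).
rewrite mulrCA -mulrDr; congr (_ * _); rewrite /metric mulr_sumr -big_split.
apply: eq_bigr => k _ /=; rewrite mulr_sumr -big_split; apply: eq_bigr => d _ /=.
by rewrite !mxE mulrDl mulrA.
Qed.
HB.instance Definition _ :=
  GRing.isLinear.Build R (C2 R) (C2 R) _ (normal_part y p) normal_part_linear.

(* For a tangent frame e_k = row k e, orthonormal in the induced metric,
   H = h(e_1, e_1) + h(e_2, e_2). *)
Lemma mean_curvature_frame (e : 'M[R]_2) :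
  e *m gram y p *m e^T = 1%:M ->
  mean_curvature y p =
    \sum_k second_fundamental_form y p (row k e) (row k e).
Proof.
move=> eGe.
have GE : invmx (gram y p) = e^T *m e.
  have eeG : e^T *m e *m gram y p = 1%:M by rewrite -mulmxA; exact: mulmx1C.
  have [_ Gu] := mulmx1_unit eeG.
  by rewrite -[RHS](mulmxK Gu) eeG mul1mx.
have sffE u v : second_fundamental_form y p u v =
    \sum_a \sum_b (u 0 a * v 0 b) *: second_fundamental_form y p 'e_a 'e_b.
  rewrite /second_fundamental_form linear_sum; apply: eq_bigr => a _.
  rewrite linear_sum; apply: eq_bigr => b _; rewrite linearZ /=; congr (_ *: _).
  congr (normal_part _ _ _).
  exact: (sum_delta_rV2 (fun i j => partial i (partial j y) p)).
rewrite /mean_curvature GE; under [RHS]eq_bigr do rewrite sffE.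
rewrite [RHS]exchange_big; apply: eq_bigr => a _ /=.
rewrite [RHS]exchange_big; apply: eq_bigr => b _ /=.
by rewrite mxE scaler_suml; apply: eq_bigr => k _; rewrite !mxE.
Qed.
End MeanCurvatureFrame.

Section Surface.
Context {R : realType} (M : oriented_surface R).

Definition smooth {W : normedModType R} (f : M -> W) : Prop :=
  forall i, smooth_on (chart_cod i) (f \o param i).

Definition immersion (x : M -> C2 R) : Prop :=
  smooth x /\ forall i p, chart_cod i p -> immersive (x \o @param _ M i) p.

Definition self_shrinker (x : M -> C2 R) : Prop :=
  forall i p, chart_cod i p -> let y := x \o @param _ M i in
    mean_curvature y p = - normal_part y p (y p).

Definition has_constant_kahler_angle (x : M -> C2 R) (theta : R) : Prop :=
  forall i p, chart_cod i p -> kahler_angle (x \o @param _ M i) p = theta.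

(* Smooth closed 1-forms; coefficients are meaningful only on [chart_cod i]. *)
Record closed_form := ClosedForm {
  coef :> chart_index M -> 'rV[R]_2 -> 'cV[R]_2;
  coef_smooth : forall i, smooth_on (chart_cod i) (coef i);
  coef_compat : forall i j p, chart_cod i p -> chart_dom j (param i p) ->
    coef i p = 'J (@chart _ M j \o param i) p
               *m coef j (chart j (param i p));
  coef_closed : forall i p, chart_cod i p ->
    partial 0 (coef i) p 1 0 = partial 1 (coef i) p 0 0
}.

Definition exact_form (a : chart_index M -> 'rV[R]_2 -> 'cV[R]_2) : Prop :=
  exists2 f : M -> R, smooth (W := R^o) f &
    forall i p, chart_cod i p -> a i p = differential (f \o param i) p.

(* Elements of H^1(M) are cosets of the exact forms in the closed forms. *)
Definition de_rham_class (a : closed_form) : set closed_form :=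
  [set b : closed_form | exact_form (fun i p => b i p - a i p)].

Definition de_rham_zero : set closed_form :=
  [set b : closed_form | exact_form b].

(* a = - d beta, where d beta is computed with arbitrary smooth local lifts of
   the Lagrangian angle beta : M -> R / 2 pi Z. *)
Definition is_maslov_form (x : M -> C2 R) (a : closed_form) : Prop :=
  forall i (U : set 'rV[R]_2) (b : 'rV[R]_2 -> R),
    open U -> U `<=` chart_cod i -> smooth_on (W := R^o) U b ->
    (forall p, U p -> lagrangian_angle (x \o @param _ M i) p (b p)) ->
    forall p, U p -> a i p = - differential b p.

End Surface.

(* Main.v *)
Require Import Defs.
From mathcomp Require Import all_boot all_order all_algebra.
From mathcomp Require Import complex.
From mathcomp Require Import all_classical all_reals all_analysis.
From mathcomp Require Import ring lra.
Set Implicit Arguments. Unset Strict Implicit. Unset Printing Implicit Defensive.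
Import Order.TTheory GRing.Theory Num.Theory.
Import numFieldNormedType.Exports.
Local Open Scope classical_set_scope.
Local Open Scope ring_scope.

(** Let [c = cos theta] and [s = 1 - c ^ 2 > 0], and suppose that the Maslov form
    is exact, [alpha = d f]. Up to a locally constant term [f] is minus the
    Lagrangian angle [beta].

    In an oriented orthonormal tangent frame [e_1, e_2] put
    [nu_1 = J e_1 - c e_2] and [nu_2 = J e_2 + c e_1]. These vectors are normal,
    orthogonal to each other and of squared length [s]. Differentiating the
    equation [<J e_1, e_2> = c] shows that [<nu_a, h(e_v, e_b)>] is totally
    symmetric in [a, v, b]; differentiating [Omega(e_1, e_2) = sqrt s e^(i beta)]
    expresses [s d beta(e_v)] as the trace of this tensor, that is, as
    [<nu_v, H>]. For a self-shrinker this reads [s d f(e_v) = <nu_v, x>]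
    ([maslov_frame]), so [|x^perp| ^ 2 = s |grad f| ^ 2], and taking the divergence
    gives the drift equation [L f = 0] for the operator
    [L u = Delta u - <x, grad u>] ([drift_laplacian]).

    One could now invoke the strong maximum principle to see that [f] is locally
    constant, whence [x^perp = 0], and contradict [Delta |x| ^ 2 = 4 + 2 <x, H>].
    A single function does both steps with nothing but the second derivative
    test. Indeed [L (f ^ 2 / 2) = |grad f| ^ 2 = |x^perp| ^ 2 / s], whereas
    [L e^(|x| ^ 2 / 2) = e^(|x| ^ 2 / 2) (2 - |x^perp| ^ 2)]. For
    [C = s e^(max |x| ^ 2 / 2)] the operator [L] therefore maps
    [e^(|x| ^ 2 / 2) + C f ^ 2 / 2] to a positive function, so that this sum has no
    local maximum ([no_local_maximum]); but it has a maximum, [M] being compact.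

    The form [alpha] is given only through smooth local lifts of the Lagrangian
    angle. Such lifts are arctangents of quotients of polynomials in the first
    derivatives of [x] ([local_angle_lift]), and they yield the algebraic formula
    [maslov_formE] for the coefficients of [alpha]. *)

(** * Differentiation along lines *)

Lemma derive_line {R : realType} {V W : normedModType R} (f : V -> W) p v :
  'D_v f p = 'D_1 (fun h : R => f (h *: v + p)) 0.
Proof.
rewrite /derive; set g1 := fun h => h^-1 *: _; set g2 := fun h => h^-1 *: _.
suff -> : g1 = g2 by [].
by apply/funext => h; rewrite /g1 /g2 /= addr0 scale0r add0r [_%:A]mulr1.
Qed.

Lemma is_derive_lineP {R : realType} {V W : normedModType R} (f : V -> W) p v d :
  is_derive p v f d <-> is_derive (0 : R) 1 (fun h : R => f (h *: v + p)) d.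
Proof.
split=> -[df <-]; split.
- exact: (derivable1P f p v).1.
- by rewrite -derive_line.
- exact: (derivable1P f p v).2.
- by rewrite derive_line.
Qed.

Lemma is_derive_cvg {R : realType} {V : normedModType R} (f : V -> R) p v d :
  is_derive p v f d ->
  (fun h : R => h^-1 * (f (h *: v + p) - f p)) @ 0^' --> d.
Proof. by move=> [df <-]; exact: df. Qed.

Section RealCalculus.
Context {R : realType} {V : normedModType R}.
Implicit Types (f g : V -> R) (p u v : V).

Lemma is_derive_line f p v (t d : R) : is_derive (t *: v + p) v f d ->
  is_derive t 1 (fun h : R => f (h *: v + p)) d.
Proof.
move=> /is_derive_lineP df; apply/is_derive_lineP.
suff -> : (fun h : R => f ((h *: (1 : R^o) + t) *: v + p)) =
          (fun h : R => f (h *: v + (t *: v + p))) by exact: df.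
by apply/funext => h; rewrite [h *: _]mulr1 scalerDl addrA.
Qed.

Lemma is_derive1_chain (l phi : R -> R) (t a b : R) :
  is_derive t 1 l a -> is_derive (l t) 1 phi b ->
  is_derive t 1 (phi \o l) (b * a).
Proof.
move=> [dl <-] [dp <-]; split.
  by apply/derivable1_diffP; apply: differentiable_comp;
    apply/derivable1_diffP; [exact: dl | exact: dp].
by have := @derive1_comp R l phi t dl dp; rewrite !derive1E; exact.
Qed.

Lemma is_derive_chain (phi : R -> R) f p v (a b : R) :
  is_derive p v f a -> is_derive (f p) 1 phi b ->
  is_derive p v (phi \o f) (b * a).
Proof.
move=> /is_derive_lineP df dphi; apply/is_derive_lineP.
apply: (is_derive1_chain df).
by rewrite scale0r add0r.
Qed.

Lemma is_derive_scale_direction f p v (c d : R) :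
  is_derive p v f d -> is_derive p (c *: v) f (c * d).
Proof.
move=> df; apply/is_derive_lineP.
have dc : is_derive (0 : R) 1 (fun h : R => h * c) c.
  have := @is_deriveZ R R R id c 0 1 1 (@is_derive_id _ _ _ _).
  rewrite [c *: _]mulr1; congr (is_derive _ _ _ _).
  by apply/funext => h; exact: mulrC.
have df0 : is_derive (0 * c) 1 (fun h : R => f (h *: v + p)) d.
  by rewrite mul0r; exact: (is_derive_lineP _ _ _ _).1.
have := is_derive1_chain dc df0.
rewrite mulrC; congr (is_derive _ _ _ _).
by apply/funext => h /=; rewrite scalerA.
Qed.

Lemma is_deriveM_real f g p v (a b : R) :
  is_derive p v f a -> is_derive p v g b ->
  is_derive p v (fun q => f q * g q) (f p * b + g p * a).
Proof. exact: is_deriveM. Qed.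

Lemma is_deriveD_real f g p v (a b : R) :
  is_derive p v f a -> is_derive p v g b ->
  is_derive p v (fun q => f q + g q) (a + b).
Proof. exact: is_deriveD. Qed.

Lemma is_derive_cst_real p v (c : R) : is_derive p v (fun=> c) 0.
Proof. exact: is_derive_cst. Qed.

Lemma is_deriveZ_real f p v (c a : R) :
  is_derive p v f a -> is_derive p v (fun q => c * f q) (c * a).
Proof. exact: is_deriveZ. Qed.

Lemma is_derive_real_eq f p v (a b : R) :
  is_derive p v f a -> a = b -> is_derive p v f b.
Proof. by move=> df <-. Qed.

Lemma is_deriveB_real f g p v (a b : R) :
  is_derive p v f a -> is_derive p v g b ->
  is_derive p v (fun q => f q - g q) (a - b).
Proof. exact: is_deriveB. Qed.

Lemma is_derive1_continuous_within (l dl : R -> R) (a b : R) :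
  (forall t, a <= t <= b -> is_derive t 1 l (dl t)) ->
  {within `[a, b], continuous l}.
Proof.
move=> der; apply: derivable_within_continuous => t; rewrite in_itv /=.
by move=> /der [].
Qed.

Lemma mean_value_line (l dl : R -> R) (a b : R) : a < b ->
  (forall t, a <= t <= b -> is_derive t 1 l (dl t)) ->
  exists2 t : R, a < t < b & l b - l a = dl t * (b - a).
Proof.
move=> ab der.
have [t tI E] := @MVT R l dl a b ab
  (fun x xI => der x (subset_itv_oo_cc xI)) (is_derive1_continuous_within der).
by exists t => //; rewrite in_itv in tI.
Qed.

Lemma mean_value_segment f (df : V -> R) p v :
  (forall t : R, 0 <= t <= 1 ->
     is_derive (t *: v + p) v f (df (t *: v + p))) ->
  exists2 t : R, 0 <= t <= 1 & f (v + p) - f p = df (t *: v + p).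
Proof.
move=> der.
have [t /andP[t0 t1]] := @mean_value_line (fun h : R => f (h *: v + p))
  (fun h : R => df (h *: v + p)) 0 1 ltr01
  (fun t t01 => is_derive_line (der t t01)).
rewrite scale1r scale0r add0r subr0 mulr1 => E.
by exists t => //; rewrite !ltW.
Qed.

Lemma is_derive_translate f p v w (d : R) : is_derive (w + p) v f d ->
  is_derive p v (fun q => f (w + q)) d.
Proof.
move=> /is_derive_lineP df; apply/is_derive_lineP.
suff -> : (fun h : R => f (w + (h *: v + p))) =
          (fun h : R => f (h *: v + (w + p))) by exact: df.
by apply/funext => h; rewrite addrCA.
Qed.

(** The mean value theorem gives no control over its intermediate points, hence
    the uniformity in [s] and [t]. *)
Lemma near_parallelogram (A : set V) p u v : nbhs p A ->
  \forall h \near (0 : R), forall s t : R, 0 <= s <= 1 -> 0 <= t <= 1 ->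
    A ((s * h) *: u + ((t * h) *: v + p)).
Proof.
move=> /nbhs_ballP[e /= e0 eA].
have N0 : 0 < `|u| + `|v| + 1 by rewrite ltr_wpDl // addr_ge0.
have eN : 0 < e / (`|u| + `|v| + 1) by rewrite divr_gt0.
near=> h => s t /andP[s0 s1] /andP[t0 t1]; apply: eA.
rewrite -ball_normE /= addrA opprD addrCA subrr addr0 normrN.
have hN : `|h| * (`|u| + `|v| + 1) < e.
  by rewrite -ltr_pdivlMr //; near: h; exact: nbhs0_lt.
apply: le_lt_trans hN; apply: (le_trans (ler_normD _ _)).
have shrink (r : R) (w : V) : 0 <= r -> r <= 1 ->
    `|(r * h) *: w| <= `|h| * `|w|.
  move=> r0 r1; rewrite normrZ ler_wpM2r // (@normrM R) ger0_norm //.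
  exact: ler_piMl.
rewrite !mulrDr mulr1 -[leLHS]addr0.
by apply: lerD => //; apply: lerD; exact: shrink.
Unshelve. all: by end_near. Qed.

Lemma cvg_is_derive f p v (d : R) :
  (fun h : R => h^-1 * (f (h *: v + p) - f p)) @ 0^' --> d ->
  is_derive p v f d.
Proof.
move=> fd; split; first by apply/cvg_ex; exists d; exact: fd.
by apply: cvg_lim; [exact: Rhausdorff | exact: fd].
Qed.

(** * Continuity of partial derivatives, mixed derivatives and maxima *)

(** The increment along [u + v] is split at the corner [h *: u + p]; the mean
    value theorem turns its second half into a value of the continuous
    derivative along [v] near [p]. *)
Lemma is_derive_add_direction f (fv : V -> R) (U : set V) p u v (d : R) :
  nbhs p U -> (forall q, U q -> is_derive q v f (fv q)) ->
  {for p, continuous fv} -> is_derive p u f d ->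
  is_derive p (u + v) f (d + fv p).
Proof.
move=> Up der cfv /is_derive_cvg fu; apply: cvg_is_derive.
have E : (fun h : R => h^-1 * (f (h *: (u + v) + p) - f p)) =
  (fun h : R => h^-1 * (f (h *: u + p) - f p) +
     h^-1 * (f (h *: v + (h *: u + p)) - f (h *: u + p))).
  apply/funext => h; rewrite -mulrDr; congr (_ * _).
  have -> : h *: (u + v) + p = h *: v + (h *: u + p).
    by rewrite scalerDr -addrA addrCA.
  ring.
rewrite E; apply: cvgD => //.
apply/cvgrPdist_lt => /= e e0.
have near_p : nbhs p [set q | U q /\ `|fv p - fv q| < e].
  apply: filterI => //.
  by move/cvgrPdist_lt : cfv => /(_ e e0).
have := near_parallelogram v u near_p.
rewrite -nbhs_nearE => /(@nbhs_dnbhs R) H.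
near=> h.
have h0 : h != 0 by near: h; exact: nbhs_dnbhs_neq.
have Hh : forall s t : R, 0 <= s <= 1 -> 0 <= t <= 1 ->
    [set q | U q /\ `|fv p - fv q| < e] ((s * h) *: v + ((t * h) *: u + p)).
  by near: h; exact: H.
have side (s : R) : 0 <= s <= 1 ->
    U (s *: (h *: v) + (h *: u + p)) /\
    `|fv p - fv (s *: (h *: v) + (h *: u + p))| < e.
  by move=> s01; have := Hh s 1 s01; rewrite mul1r scalerA ler01 lexx; exact.
have [s s01 ->] := @mean_value_segment f (fun q => h * fv q) (h *: u + p)
  (h *: v) (fun s s01 => is_derive_scale_direction h (der _ (side s s01).1)).
by rewrite mulKf //; case: (side s s01).
Unshelve. all: by end_near. Qed.

(** The mean value theorem is applied first along [u], to the difference of [f]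
    on two opposite sides of the parallelogram, and then along [v]. *)
Lemma second_difference f (fu fuv : V -> R) (U : set V) p u v :
  nbhs p U -> (forall q, U q -> is_derive q u f (fu q)) ->
  (forall q, U q -> is_derive q v fu (fuv q)) -> {for p, continuous fuv} ->
  forall e : R, 0 < e -> \forall h \near (0 : R),
    exists2 d, `|fuv p - d| < e &
    f (h *: v + (h *: u + p)) - f (h *: u + p) - (f (h *: v + p) - f p)
      = h ^+ 2 * d.
Proof.
move=> Up dfu dfuv cfuv e e0.
have near_p : nbhs p [set q | U q /\ `|fuv p - fuv q| < e].
  apply: filterI => //.
  by move/cvgrPdist_lt : cfuv => /(_ e e0).
apply: filterS (near_parallelogram v u near_p) => h Hh.
have corner (t : R) : 0 <= t <= 1 ->
    U (h *: v + (t *: (h *: u) + p)) /\ U (t *: (h *: u) + p).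
  move=> t01; rewrite scalerA.
  have [] := Hh 1 t; rewrite ?mul1r ?ler01 ?lexx //.
  have [] := Hh 0 t; rewrite ?mul0r ?scale0r ?add0r ?ler01 ?lexx //.
have der_edge (t : R) : 0 <= t <= 1 ->
    is_derive (t *: (h *: u) + p) (h *: u) (fun q => f (h *: v + q) - f q)
      (h * (fu (h *: v + (t *: (h *: u) + p)) - fu (t *: (h *: u) + p))).
  move=> /corner[U1 U2]; apply: is_derive_scale_direction.
  apply: is_deriveB; last exact: dfu.
  by apply: is_derive_translate; exact: dfu.
have [t t01 ->] := @mean_value_segment _
  (fun q => h * (fu (h *: v + q) - fu q)) p (h *: u) der_edge.
have side (s : R) : 0 <= s <= 1 ->
    U (s *: (h *: v) + (t *: (h *: u) + p)) /\
    `|fuv p - fuv (s *: (h *: v) + (t *: (h *: u) + p))| < e.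
  by move=> s01; have := Hh s t s01 t01; rewrite !scalerA; exact.
have [s s01 ->] := @mean_value_segment fu (fun q => h * fuv q) _ (h *: v)
  (fun s s01 => is_derive_scale_direction h (dfuv _ (side s s01).1)).
exists (fuv (s *: (h *: v) + (t *: (h *: u) + p))); first exact: (side s s01).2.
by rewrite expr2 mulrA.
Qed.

(** The second difference of [f] on the parallelogram spanned by [h *: u] and
    [h *: v] is symmetric in [u] and [v], so both mixed derivatives are its limit
    after division by [h ^+ 2]. *)
Lemma schwarz f (fu fv fuv fvu : V -> R) (U : set V) p u v :
  nbhs p U ->
  (forall q, U q -> is_derive q u f (fu q)) ->
  (forall q, U q -> is_derive q v f (fv q)) ->
  (forall q, U q -> is_derive q v fu (fuv q)) ->
  (forall q, U q -> is_derive q u fv (fvu q)) ->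
  {for p, continuous fuv} -> {for p, continuous fvu} ->
  fuv p = fvu p.
Proof.
move=> Up dfu dfv dfuv dfvu cuv cvu; apply/eqP; rewrite -subr_eq0 -normr_le0.
apply/ler_addgt0Pl => e e0; rewrite addr0.
have e2 : 0 < e / 2 by rewrite divr_gt0.
have H1 := second_difference Up dfu dfuv cuv e2.
have H2 := second_difference Up dfv dfvu cvu e2.
have H : \forall h \near (0 : R)^', `|fuv p - fvu p| <= e.
  near=> h.
  have h0 : h != 0 by near: h; exact: nbhs_dnbhs_neq.
  have [a a1 a2] : exists2 d, `|fuv p - d| < e / 2 &
    f (h *: v + (h *: u + p)) - f (h *: u + p) - (f (h *: v + p) - f p)
      = h ^+ 2 * d by near: h; exact: nbhs_dnbhs.
  have [b b1 b2] : exists2 d, `|fvu p - d| < e / 2 &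
    f (h *: u + (h *: v + p)) - f (h *: v + p) - (f (h *: u + p) - f p)
      = h ^+ 2 * d by near: h; exact: nbhs_dnbhs.
  have ab : a = b.
    apply: (@mulfI _ (h ^+ 2)); first by rewrite expf_neq0.
    by rewrite -a2 -b2 addrCA; ring.
  rewrite -ab in b1; rewrite -(subrKA a) (splitr e).
  apply: (le_trans (ler_normD _ _)); apply: lerD; apply: ltW => //.
  by rewrite distrC.
by have [h] := @filter_ex _ _ _ _ H.
Unshelve. all: by end_near. Qed.

(** The first derivative vanishes by Fermat; were the second one positive, the
    first would be positive just after [0] and the mean value theorem would give
    larger values there. *)
Lemma second_derivative_test_line (l dl : R -> R) (d : R) :
  (\forall t \near (0 : R), is_derive (t : R) 1 l (dl t)) ->
  is_derive (0 : R) 1 dl d ->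
  (\forall t \near (0 : R), l t <= l 0) -> dl 0 = 0 /\ d <= 0.
Proof.
move=> der der2 max0.
have : \forall t \near (0 : R), is_derive (t : R) 1 l (dl t) /\ l t <= l 0.
  by apply: filterI.
rewrite -nbhs_nearE => /nbhs_ballP[e /= e0 eA].
have near0 (t : R) : t \in `](- e), e[%R ->
    is_derive t 1 l (dl t) /\ l t <= l 0.
  rewrite in_itv /= => te; apply: eA.
  by rewrite -ball_normE /= sub0r normrN ltr_norml.
have e0' : (0 : R) \in `](- e), e[%R by rewrite in_itv /= e0 oppr_lt0 e0.
have ee : - e <= e by rewrite ge0_cp // ltW.
have dl0 : dl 0 = 0.
  have [_ <-] := (near0 0 e0').1.
  have [_ E] := @derive1_at_max _ l (- e) e 0 ee
    (fun t te => @ex_derive _ _ _ _ _ _ _ (near0 t te).1) e0'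
    (fun t te => (near0 t te).2).
  exact: E.
split=> //; rewrite leNgt; apply/negP => d0.
have : (fun h : R => h^-1 * (dl h - dl 0)) @ 0^' --> d.
  have := @is_derive_cvg R R dl 0 1 d der2.
  suff -> : (fun h : R => h^-1 * (dl (h *: (1 : R^o) + 0) - dl 0)) =
     (fun h => h^-1 * (dl h - dl 0)) by exact.
  by apply/funext => h; rewrite addr0 [h *: _]mulr1.
move=> /cvgrPdist_lt /(_ d d0) [r /= r0 rP].
pose b := Num.min e r / 2.
have b0 : 0 < b by rewrite divr_gt0 // lt_min e0 r0.
have be : b < e.
  by rewrite ltr_pdivrMr // mulr_natr mulr2n ltr_pwDl // ge_min lexx.
have br : b < r.
  by rewrite ltr_pdivrMr // mulr_natr mulr2n ltr_pwDl // ge_min lexx orbT.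
have sub (t : R) : 0 <= t <= b -> t \in `](- e), e[%R.
  move=> /andP[t0 tb]; rewrite in_itv /= (le_lt_trans tb be) andbT.
  by rewrite (lt_le_trans _ t0) // oppr_lt0.
have [t /andP[t0 tb]] := @mean_value_line l dl 0 b b0
  (fun t tb => (near0 t (sub t tb)).1).
rewrite subr0 => E.
have dlt : 0 < dl t.
  have := rP t; rewrite /= sub0r normrN gtr0_norm // => /(_ (lt_trans tb br)).
  rewrite gt_eqF // => /(_ isT); rewrite dl0 subr0 => dt.
  have : 0 < t^-1 * dl t.
    by move: dt; rewrite ltr_norml => /andP[_]; rewrite ltrBlDr ltrDl.
  by rewrite pmulr_rgt0 // invr_gt0.
have lb : l b <= l 0 by apply: (near0 b (sub b _)).2; rewrite ltW //=.
have : 0 < l b - l 0 by rewrite E mulr_gt0.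
by rewrite subr_gt0 ltNge lb.
Qed.

Lemma second_derivative_test f (df : V -> R) (U : set V) p v (d : R) :
  nbhs p U -> (forall q, U q -> is_derive q v f (df q)) ->
  is_derive p v df d -> (forall q, U q -> f q <= f p) -> df p = 0 /\ d <= 0.
Proof.
move=> Up der der2 maxp.
have near_line : \forall t \near (0 : R), U (t *: v + p).
  apply: filterS (near_parallelogram v 0 Up) => t /(_ 1 0).
  by rewrite mul1r mul0r scale0r add0r !lexx ler01; exact.
have [] := @second_derivative_test_line (fun t : R => f (t *: v + p))
  (fun t : R => df (t *: v + p)) d.
- by apply: filterS near_line => t Ut; apply: is_derive_line; exact: der.
- exact: (is_derive_lineP df p v d).1.
- by apply: filterS near_line => t Ut; rewrite scale0r add0r; exact: maxp.
by rewrite scale0r add0r.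
Qed.

End RealCalculus.

(** * Smooth functions on the plane *)

Lemma is_deriveV_real {R : realType} {V : normedModType R} (f : V -> R) p v a :
  f p != 0 -> is_derive p v f a ->
  is_derive p v (fun q => (f q)^-1) (- (f p) ^- 2 * a).
Proof.
by move=> f0 [df <-]; split; [exact: derivableV | exact: deriveV].
Qed.

Lemma near_open {T : topologicalType} (U : set T) (P : T -> Prop) p :
  open U -> U p -> (forall q, U q -> P q) -> \forall q \near p, P q.
Proof. by move=> oU Up H; apply: filterS (open_nbhs_nbhs (conj oU Up)). Qed.

Lemma near_eq_continuous {T S : topologicalType} (f g : T -> S) p :
  (\forall q \near p, f q = g q) -> {for p, continuous f} ->
  {for p, continuous g}.
Proof.
move=> fg cf; rewrite /prop_for /continuous_at -(nbhs_singleton fg).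
by apply: cvg_trans cf; exact: near_eq_cvg.
Qed.

Section PlaneSmoothness.
Context {R : realType}.
Implicit Types (f g : 'rV[R]_2 -> R) (U : set 'rV[R]_2) (p q u v : 'rV[R]_2).

(** Functions obtained from smooth ones by field operations and [atan].
    The class is closed under partial derivatives, so that all its members are
    smooth: an induction on expressions replaces the higher Leibniz and chain
    rules. *)
Inductive smooth_expr U : ('rV[R]_2 -> R) -> Prop :=
| smooth_expr_base f of smooth_on (W := R) U f : smooth_expr U f
| smooth_expr_eq f g of smooth_expr U f & (forall q, U q -> f q = g q) :
    smooth_expr U g
| smooth_expr_cst c : smooth_expr U (fun=> c)
| smooth_exprD f g of smooth_expr U f & smooth_expr U g :
    smooth_expr U (fun q => f q + g q)
| smooth_exprM f g of smooth_expr U f & smooth_expr U g :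
    smooth_expr U (fun q => f q * g q)
| smooth_exprV f of smooth_expr U f & (forall q, U q -> f q != 0) :
    smooth_expr U (fun q => (f q)^-1)
| smooth_expr_atan f of smooth_expr U f : smooth_expr U (fun q => atan (f q)).

Lemma smooth_on_partial (W : normedModType R) U (f : 'rV[R]_2 -> W) k :
  smooth_on U f -> smooth_on U (partial k f).
Proof.
move=> sf s p Up; have := sf (rcons s k) p Up.
by rewrite foldr_rcons.
Qed.

Lemma smooth_on_is_derive (W : normedModType R) U (f : 'rV[R]_2 -> W) k p :
  smooth_on U f -> U p -> is_derive p 'e_k f (partial k f p).
Proof. by move=> sf /(sf [::])[_ /(_ k) df]; exact: derivableP. Qed.

Lemma smooth_exprB U f g : smooth_expr U f -> smooth_expr U g ->
  smooth_expr U (fun q => f q - g q).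
Proof.
move=> sf sg; apply: (@smooth_expr_eq _ (fun q => f q + -1 * g q)).
  by apply: smooth_exprD => //; apply: smooth_exprM => //;
    exact: smooth_expr_cst.
by move=> q _; rewrite mulN1r.
Qed.

Lemma smooth_expr_derive U f : open U -> smooth_expr U f ->
  (forall p, U p -> {for p, continuous f}) /\
  forall k, exists2 g, smooth_expr U g &
    forall p, U p -> is_derive p 'e_k f (g p).
Proof.
move=> oU; elim=> {f}.
- move=> f sf; split=> [p Up|k]; first exact: (sf [::] p Up).1.
  exists (partial k f); last by move=> p; exact: smooth_on_is_derive.
  by apply: smooth_expr_base; exact: smooth_on_partial.
- move=> f g sf [cf df] fg; split=> [p Up|k].
    have near_fg : \forall q \near p, f q = g q by exact: near_open fg.
    exact: near_eq_continuous near_fg (cf p Up).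
  have [df' sdf' Hdf] := df k; exists df' => // p Up.
  by apply: near_eq_is_derive (Hdf p Up); exact: near_open fg.
- move=> c; split=> [p Up|k]; first exact: cst_continuous.
  exists (fun=> 0); first exact: smooth_expr_cst.
  by move=> p Up; exact: is_derive_cst_real.
- move=> f g sf [cf df] sg [cg dg]; split=> [p Up|k].
    exact: (@continuousD _ _ _ f g p (cf p Up) (cg p Up)).
  have [df' sdf' Hdf] := df k; have [dg' sdg' Hdg] := dg k.
  exists (fun q => df' q + dg' q); first exact: smooth_exprD.
  by move=> p Up; apply: is_deriveD_real; [exact: Hdf | exact: Hdg].
- move=> f g sf [cf df] sg [cg dg]; split=> [p Up|k].
    exact: (@continuousM _ _ f g p (cf p Up) (cg p Up)).
  have [df' sdf' Hdf] := df k; have [dg' sdg' Hdg] := dg k.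
  exists (fun q => f q * dg' q + g q * df' q).
    by apply: smooth_exprD; apply: smooth_exprM.
  by move=> p Up; apply: is_deriveM_real; [exact: Hdf | exact: Hdg].
- move=> f sf [cf df] f0; split=> [p Up|k].
    exact: (@continuousV _ _ f p (f0 p Up) (cf p Up)).
  have [df' sdf' Hdf] := df k.
  exists (fun q => (-1 * ((f q)^-1 * (f q)^-1)) * df' q).
    apply: smooth_exprM => //; apply: smooth_exprM.
      exact: smooth_expr_cst.
    by apply: smooth_exprM; exact: smooth_exprV.
  move=> p Up; have := is_deriveV_real (f0 p Up) (Hdf p Up).
  by rewrite expr2 invfM mulN1r.
- move=> f sf [cf df]; split=> [p Up|k].
    by apply: continuous_comp; [exact: cf | exact: continuous_atan].
  have [df' sdf' Hdf] := df k.
  have pos q : 0 < 1 + f q * f q by rewrite ltr_wpDr // -expr2 sqr_ge0.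
  exists (fun q => (1 + f q * f q)^-1 * df' q).
    apply: smooth_exprM => //; apply: smooth_exprV.
      apply: smooth_exprD; first exact: smooth_expr_cst.
      exact: smooth_exprM.
    by move=> q _; rewrite gt_eqF.
  by move=> p Up; apply: is_derive_chain (Hdf p Up) _.
Qed.

Lemma smooth_expr_partial U f k : open U -> smooth_expr U f ->
  smooth_expr U (partial (W := R) k f).
Proof.
move=> oU sf; have [_ /(_ k)[g sg Hg]] := smooth_expr_derive oU sf.
by apply: smooth_expr_eq sg _ => q /Hg[_ <-].
Qed.

Lemma smooth_expr_smooth U f : open U -> smooth_expr U f ->
  smooth_on (W := R) U f.
Proof.
move=> oU sf s p Up.
have ss : smooth_expr U (foldr (partial (W := R)) f s).
  by elim: s => //= k s IHs; exact: smooth_expr_partial.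
have [cs ds] := smooth_expr_derive oU ss.
by split=> [|k]; [exact: cs | have [g _ /(_ p Up)[]] := ds k].
Qed.

End PlaneSmoothness.

(** * Directional derivatives of vector-valued maps *)

Section VectorValued.
Context {R : realType} {m n : nat}.
Implicit Types (Y : 'rV[R]_2 -> 'M[R]_(m, n)) (U : set 'rV[R]_2).

Lemma is_derive_mxP {V : normedModType R} (A : V -> 'M[R]_(m, n)) p v A' :
  is_derive p v A A' <->
  forall i j, is_derive p v (fun q => A q i j) (A' i j).
Proof.
split=> [[dA <-] i j|dA].
  split; first exact: (derivable_mxP A p v).1.
  by rewrite derive_mx // mxE.
have dA' : derivable A p v.
  by apply/derivable_mxP => i j; case: (dA i j).
split; first exact: dA'.
by rewrite derive_mx //; apply/matrixP => i j; rewrite mxE; case: (dA i j).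
Qed.

(** The iterated partial derivatives of a coordinate are the coordinates of those
    of [Y] on [U] only; openness of [U] makes this enough to differentiate. *)
Lemma smooth_on_coord U Y i j : open U -> smooth_on U Y ->
  smooth_on (W := R) U (fun q => Y q i j).
Proof.
move=> oU sY.
have E s p : U p ->
    foldr (partial (W := R)) (fun q => Y q i j) s p = foldr partial Y s p i j.
  elim: s p => //= k s IHs p Up.
  have [_ /(_ k) dY] := sY s p Up.
  have [_ <-] := (is_derive_mxP _ _ _ _).1 (derivableP dY) i j.
  by apply: near_eq_derive; exact: near_open IHs.
move=> s p Up; have [cY dY] := sY s p Up.
have near_coord : \forall q \near p, foldr partial Y s q i j =
    foldr (partial (W := R)) (fun q => Y q i j) s q.
  by apply: near_open oU Up _ => q Uq; rewrite E.
split=> [|k].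
  apply: near_eq_continuous near_coord _.
  apply: (@continuous_comp _ _ _ (foldr partial Y s) (fun M => M i j)) => //.
  exact: coord_continuous.
by apply: near_eq_derivable near_coord _; exact: (derivable_mxP _ _ _).1.
Qed.

End VectorValued.

Section DirectionalDerivative.
Context {R : realType}.
Implicit Types (U : set 'rV[R]_2) (p q u v : 'rV[R]_2).

(** Derivatives in constant directions, in terms of the partial ones; [dir2 u v]
    differentiates first along [v] and then along [u]. Derivatives
    in constant directions commute, and the directions can be chosen so as to give
    an orthonormal tangent frame at one prescribed point. *)
Definition dir {W : normedModType R} u (f : 'rV[R]_2 -> W) q : W :=
  \sum_a u 0 a *: partial a f q.

Definition dir2 {W : normedModType R} u v (f : 'rV[R]_2 -> W) q : W :=
  \sum_a \sum_b (u 0 a * v 0 b) *: partial a (partial b f) q.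

Lemma ord2P (k : 'I_2) : k = 0 \/ k = 1.
Proof. by case: k => -[|[|//]] k2; [left|right]; exact/val_inj. Qed.

Lemma row2E u : u = u 0 0 *: 'e_0 + u 0 1 *: 'e_1.
Proof.
apply/rowP => i; rewrite !mxE; case: (ord2P i) => -> /=.
  by rewrite mulr1 mulr0 addr0.
by rewrite mulr1 mulr0 add0r.
Qed.

Lemma sum2E {W : nmodType} (F : 'I_2 -> W) : \sum_a F a = F 0 + F 1.
Proof.
by rewrite !big_ord_recl big_ord0 addr0; congr (_ + F _); apply/val_inj.
Qed.

Lemma dirE {W : normedModType R} u (f : 'rV[R]_2 -> W) q :
  dir u f q = u 0 0 *: partial 0 f q + u 0 1 *: partial 1 f q.
Proof. exact: sum2E. Qed.

Lemma dir2E {W : normedModType R} u v (f : 'rV[R]_2 -> W) q :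
  dir2 u v f q =
    v 0 0 *: dir u (partial 0 f) q + v 0 1 *: dir u (partial 1 f) q.
Proof.
rewrite /dir2 exchange_big sum2E; congr (_ + _); rewrite /dir scaler_sumr;
  by apply: eq_bigr => a _; rewrite scalerA mulrC.
Qed.

Lemma dir2_fullE {W : normedModType R} u v (f : 'rV[R]_2 -> W) q :
  dir2 u v f q =
    v 0 0 *: (u 0 0 *: partial 0 (partial 0 f) q +
              u 0 1 *: partial 1 (partial 0 f) q) +
    v 0 1 *: (u 0 0 *: partial 0 (partial 1 f) q +
              u 0 1 *: partial 1 (partial 1 f) q).
Proof. by rewrite dir2E !dirE. Qed.

Lemma dir_realE u (f : 'rV[R]_2 -> R) q :
  dir u f q = u 0 0 * partial 0 f q + u 0 1 * partial 1 f q.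
Proof. exact: dirE. Qed.

Lemma dir2_realE u v (f : 'rV[R]_2 -> R) q :
  dir2 u v f q = v 0 0 * dir u (partial 0 f) q + v 0 1 * dir u (partial 1 f) q.
Proof. exact: dir2E. Qed.

Lemma is_derive_dir_real U (f : 'rV[R]_2 -> R) u p : open U -> U p ->
  smooth_on (W := R) U f -> is_derive p u f (dir u f p).
Proof.
move=> oU Up sf; rewrite {1}[u]row2E dir_realE.
apply: (@is_derive_add_direction _ _ f (fun q => u 0 1 * partial 1 f q) U).
- exact: open_nbhs_nbhs.
- move=> q Uq; apply: is_derive_scale_direction.
  exact: smooth_on_is_derive sf Uq.
- apply: continuousM; first exact: cst_continuous.
  exact: (sf [:: 1] p Up).1.
- by apply: is_derive_scale_direction; exact: smooth_on_is_derive sf Up.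
Qed.

Lemma partialC_real U (f : 'rV[R]_2 -> R) a b p : open U -> U p ->
  smooth_on (W := R) U f ->
  partial a (partial b f) p = partial b (partial a f) p.
Proof.
move=> oU Up sf.
apply: (@schwarz _ _ f (partial b f) (partial a f) _ _ U p 'e_b 'e_a).
- exact: open_nbhs_nbhs.
- by move=> q Uq; exact: smooth_on_is_derive sf Uq.
- by move=> q Uq; exact: smooth_on_is_derive sf Uq.
- by move=> q Uq; apply: smooth_on_is_derive Uq; exact: smooth_on_partial.
- by move=> q Uq; apply: smooth_on_is_derive Uq; exact: smooth_on_partial.
- exact: (sf [:: a; b] p Up).1.
- exact: (sf [:: b; a] p Up).1.
Qed.

Lemma is_derive_dir2_real U (f : 'rV[R]_2 -> R) u v p : open U -> U p ->
  smooth_on (W := R) U f -> is_derive p u (dir v f) (dir2 u v f p).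
Proof.
move=> oU Up sf.
have -> : dir v f = fun q => v 0 0 * partial 0 f q + v 0 1 * partial 1 f q.
  by apply/funext => q; rewrite dir_realE.
rewrite dir2_realE; apply: is_deriveD_real.
  apply: is_deriveZ_real.
  by apply: (is_derive_dir_real _ oU Up); exact: smooth_on_partial.
apply: is_deriveZ_real.
by apply: (is_derive_dir_real _ oU Up); exact: smooth_on_partial.
Qed.

Context {m n : nat}.
Implicit Types (Y : 'rV[R]_2 -> 'M[R]_(m, n)).

Lemma partial_coord U Y i j a p : U p -> smooth_on U Y ->
  partial a Y p i j = partial (W := R) a (fun q => Y q i j) p.
Proof.
move=> Up sY; have dY := smooth_on_is_derive a sY Up.
by have [_ <-] := (is_derive_mxP _ _ _ _).1 dY i j.
Qed.

Lemma partial2_coord U Y i j a b p : open U -> U p -> smooth_on U Y ->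
  partial a (partial b Y) p i j =
  partial (W := R) a (partial (W := R) b (fun q => Y q i j)) p.
Proof.
move=> oU Up sY; rewrite (partial_coord _ _ _ Up (smooth_on_partial _ sY)).
apply: near_eq_derive; apply: near_open oU Up _ => q Uq.
exact: partial_coord sY.
Qed.

Lemma dir_coord U Y i j u p : U p -> smooth_on U Y ->
  dir u Y p i j = dir (W := R) u (fun q => Y q i j) p.
Proof.
move=> Up sY; rewrite /dir summxE; apply: eq_bigr => a _.
by rewrite mxE (partial_coord _ _ _ Up sY).
Qed.

Lemma dir2_coord U Y i j u v p : open U -> U p -> smooth_on U Y ->
  dir2 u v Y p i j = dir2 (W := R) u v (fun q => Y q i j) p.
Proof.
move=> oU Up sY; rewrite /dir2 summxE; apply: eq_bigr => a _.
rewrite summxE; apply: eq_bigr => b _.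
by rewrite mxE (partial2_coord _ _ _ _ oU Up sY).
Qed.

Lemma is_derive_dir U Y u p : open U -> U p -> smooth_on U Y ->
  is_derive p u Y (dir u Y p).
Proof.
move=> oU Up sY; apply/is_derive_mxP => i j; rewrite (dir_coord _ _ _ Up sY).
by apply: (is_derive_dir_real _ oU Up); exact: (smooth_on_coord i j oU sY).
Qed.

Lemma is_derive_dir2 U Y u v p : open U -> U p -> smooth_on U Y ->
  is_derive p u (dir v Y) (dir2 u v Y p).
Proof.
move=> oU Up sY; apply/is_derive_mxP => i j.
rewrite (dir2_coord _ _ _ _ oU Up sY).
apply: (@near_eq_is_derive _ _ _ (dir (W := R) v (fun q => Y q i j))).
  apply: near_open oU Up _ => q Uq; exact/esym/(dir_coord _ _ _ Uq sY).
by apply: (is_derive_dir2_real _ _ oU Up); exact: (smooth_on_coord i j oU sY).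
Qed.

Lemma partialC U Y a b p : open U -> U p -> smooth_on U Y ->
  partial a (partial b Y) p = partial b (partial a Y) p.
Proof.
move=> oU Up sY; apply/matrixP => i j.
apply: etrans (partial2_coord i j a b oU Up sY) _.
apply: etrans _ (esym (partial2_coord i j b a oU Up sY)).
exact: (partialC_real _ _ oU Up (smooth_on_coord i j oU sY)).
Qed.

Lemma dir2C U Y u v p : open U -> U p -> smooth_on U Y ->
  dir2 u v Y p = dir2 v u Y p.
Proof.
move=> oU Up sY; rewrite /dir2 exchange_big; apply: eq_bigr => b _.
by apply: eq_bigr => a _; rewrite (partialC a b oU Up sY) (mulrC (u 0 a)).
Qed.

End DirectionalDerivative.

(** * Metric, Kaehler form and holomorphic volume *)

Section ComplexPlaneAlgebra.
Context {R : realType}.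
Implicit Types (U V W X Z : C2 R).

Lemma metricE U V : metric U V =
  U 0 0 * V 0 0 + U 0 1 * V 0 1 + (U 1 0 * V 1 0 + U 1 1 * V 1 1).
Proof. by rewrite /metric sum2E !sum2E. Qed.

Lemma kahler_formE U V : kahler_form U V =
  U 0 0 * V 0 1 - U 0 1 * V 0 0 + (U 1 0 * V 1 1 - U 1 1 * V 1 0).
Proof. by rewrite /kahler_form metricE !mxE /=; ring. Qed.

Definition re_vol U V : R :=
  U 0 0 * V 1 0 - U 0 1 * V 1 1 - (V 0 0 * U 1 0 - V 0 1 * U 1 1).

Definition im_vol U V : R :=
  U 0 0 * V 1 1 + U 0 1 * V 1 0 - (V 0 0 * U 1 1 + V 0 1 * U 1 0).

Lemma holomorphic_volumeE U V :
  holomorphic_volume U V = (re_vol U V +i* im_vol U V)%C.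
Proof. by []. Qed.

Lemma metricC U V : metric U V = metric V U.
Proof. by rewrite !metricE; ring. Qed.

Lemma metric_ge0 U : 0 <= metric U U.
Proof. by rewrite metricE -!expr2 !addr_ge0 ?sqr_ge0. Qed.

Lemma metric_eq0 U : metric U U = 0 -> U = 0.
Proof.
rewrite metricE -!expr2 => /eqP.
rewrite !paddr_eq0 ?addr_ge0 ?sqr_ge0 // !sqrf_eq0 => /andP[].
move=> /andP[/eqP u0 /eqP u1] /andP[/eqP u2 /eqP u3].
apply/matrixP => i j; rewrite mxE.
by case: (ord2P i) => ->; case: (ord2P j) => ->.
Qed.

Lemma kahler_formC U V : kahler_form U V = - kahler_form V U.
Proof. by rewrite !kahler_formE; ring. Qed.

Lemma kahler_form0 U : kahler_form U U = 0.
Proof. by rewrite !kahler_formE; ring. Qed.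

Lemma metricDr U V W : metric U (V + W) = metric U V + metric U W.
Proof. by rewrite !metricE !mxE; ring. Qed.

Lemma metricZr a U V : metric U (a *: V) = a * metric U V.
Proof. by rewrite !metricE !mxE; ring. Qed.

Lemma metricDl U V W : metric (V + W) U = metric V U + metric W U.
Proof. by rewrite !metricE !mxE; ring. Qed.

Lemma metricZl a U V : metric (a *: V) U = a * metric V U.
Proof. by rewrite !metricE !mxE; ring. Qed.

Lemma kahler_formDr U V W :
  kahler_form U (V + W) = kahler_form U V + kahler_form U W.
Proof. by rewrite !kahler_formE !mxE; ring. Qed.

Lemma kahler_formZr a U V : kahler_form U (a *: V) = a * kahler_form U V.
Proof. by rewrite !kahler_formE !mxE; ring. Qed.

Lemma kahler_formDl U V W :
  kahler_form (V + W) U = kahler_form V U + kahler_form W U.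
Proof. by rewrite !kahler_formE !mxE; ring. Qed.

Lemma kahler_formZl a U V : kahler_form (a *: V) U = a * kahler_form V U.
Proof. by rewrite !kahler_formE !mxE; ring. Qed.

(** Imaginary part of the Lagrange identity
    [conj (Omega U V) * Omega W Z = h U W * h V Z - h U Z * h V W] for the
    Hermitian product [h = metric + i * kahler_form]. *)
Lemma im_conj_vol U V W Z :
  re_vol U V * im_vol W Z - im_vol U V * re_vol W Z =
  metric U W * kahler_form V Z + kahler_form U W * metric V Z
  - (metric U Z * kahler_form V W + kahler_form U Z * metric V W).
Proof.
by rewrite !metricE !kahler_formE /re_vol /im_vol; ring.
Qed.

(** The same identity for the modulus: the holomorphic volume and the Kaehler form
    measure complementary parts of the area, which are [sin theta ^ 2] and
    [cos theta ^ 2] times its square. *)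
Lemma norm_vol U V : re_vol U V ^+ 2 + im_vol U V ^+ 2 =
  metric U U * metric V V - metric U V ^+ 2 - kahler_form U V ^+ 2.
Proof. by rewrite !metricE !kahler_formE /re_vol /im_vol; ring. Qed.

(** Three vectors of the complex plane are linearly dependent over the complex
    numbers, so the determinant of their Gram matrix for the Hermitian product
    [metric + i * kahler_form] vanishes. For an orthonormal frame this computes
    the squared length of the normal part of [X]. *)
Lemma hermitian_gram0 U V X :
  metric X X * (metric U U * metric V V - metric U V ^+ 2
                - kahler_form U V ^+ 2)
  = metric V V * (metric U X ^+ 2 + kahler_form U X ^+ 2)
    + metric U U * (metric V X ^+ 2 + kahler_form V X ^+ 2)
    + 2 * kahler_form U V *
      (metric U X * kahler_form V X - kahler_form U X * metric V X)
    - 2 * metric U V *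
      (metric U X * metric V X + kahler_form U X * kahler_form V X).
Proof. by rewrite !metricE !kahler_formE; ring. Qed.

(** Here [Wab] are the second derivatives of the immersion in the directions of
    the orthonormal tangent frame [E1, E2], and [f1], [f2] are the derivatives of
    minus the Lagrangian angle. The forms [kahler_form E1 - c * metric E2] and
    [kahler_form E2 + c * metric E1] vanish on the tangent plane, and the
    derivative of the Kaehler angle, which is zero, makes their pairings with the
    [Wab] totally symmetric. The derivative of the angle is a trace of these
    pairings, and by symmetry it is the pairing with the trace [W11 + W22], whose
    normal part is that of [- X]. *)
Lemma maslov_frame (X E1 E2 W11 W12 W22 : C2 R) (c f1 f2 a b : R) :
  metric E1 E1 = 1 -> metric E2 E2 = 1 -> metric E1 E2 = 0 ->
  kahler_form E1 E2 = c ->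
  kahler_form W11 E2 + kahler_form E1 W12
    = c * (metric W11 E1 + metric W12 E2) ->
  kahler_form W12 E2 + kahler_form E1 W22
    = c * (metric W12 E1 + metric W22 E2) ->
  (re_vol E1 E2 ^+ 2 + im_vol E1 E2 ^+ 2) * f1 =
    im_vol E1 E2 * (re_vol W11 E2 + re_vol E1 W12)
    - re_vol E1 E2 * (im_vol W11 E2 + im_vol E1 W12) ->
  (re_vol E1 E2 ^+ 2 + im_vol E1 E2 ^+ 2) * f2 =
    im_vol E1 E2 * (re_vol W12 E2 + re_vol E1 W22)
    - re_vol E1 E2 * (im_vol W12 E2 + im_vol E1 W22) ->
  W11 + W22 = a *: E1 + b *: E2 - X ->
  (1 - c ^+ 2) * f1 = kahler_form E1 X - c * metric E2 X /\
  (1 - c ^+ 2) * f2 = kahler_form E2 X + c * metric E1 X.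
Proof.
move=> E11 E22 E12 K angle1 angle2 maslov1 maslov2 shrink.
rewrite norm_vol E11 E22 E12 K mulr1 expr0n subr0 in maslov1 maslov2.
have K' : kahler_form E2 E1 = - c by rewrite kahler_formC K.
have E21 : metric E2 E1 = 0 by rewrite metricC.
have I1 := im_conj_vol E1 E2 W11 E2; have I2 := im_conj_vol E1 E2 E1 W12.
have I3 := im_conj_vol E1 E2 W12 E2; have I4 := im_conj_vol E1 E2 E1 W22.
rewrite ?E11 ?E22 ?E12 ?E21 ?K ?K' ?kahler_form0 in I1 I2 I3 I4.
have S1 : kahler_form E1 (W11 + W22) = b * c - kahler_form E1 X.
  rewrite shrink -scaleN1r !kahler_formDr !kahler_formZr K kahler_form0; ring.
have S2 : kahler_form E2 (W11 + W22) = - (a * c) - kahler_form E2 X.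
  rewrite shrink -scaleN1r !kahler_formDr !kahler_formZr K' kahler_form0; ring.
have S3 : metric E1 (W11 + W22) = a - metric E1 X.
  rewrite shrink -scaleN1r !metricDr !metricZr E11 E12; ring.
have S4 : metric E2 (W11 + W22) = b - metric E2 X.
  rewrite shrink -scaleN1r !metricDr !metricZr E21 E22; ring.
rewrite !kahler_formDr in S1 S2; rewrite !metricDr in S3 S4.
rewrite (kahler_formC W11) (metricC W11) (metricC W12) in angle1.
rewrite (kahler_formC W12) (metricC W12) (metricC W22) in angle2.
split; [rewrite maslov1|rewrite maslov2].
  have cS4 := congr1 (fun t => c * t) S4; rewrite mulrDr in cS4; lra.
have cS3 := congr1 (fun t => c * t) S3; rewrite mulrDr in cS3; lra.
Qed.
End ComplexPlaneAlgebra.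

(** * Tangent frames *)

Section FrameAlgebra.
Context {R : realType}.
Implicit Types (U V W X P Q E : C2 R).

Definition gram_det U V := metric U U * metric V V - metric U V ^+ 2.

(** The equations of [maslov_frame] in a form valid in every frame. An orthonormal
    frame of constant directions exists only at a single point, so that it is
    this form which can be differentiated. *)
Lemma maslov_any_frame (X E1 E2 : C2 R) (c f1 f2 a1 a2 b1 b2 : R) :
  metric E1 E1 = 1 -> metric E2 E2 = 1 -> metric E1 E2 = 0 ->
  kahler_form E1 E2 = c ->
  (1 - c ^+ 2) * f1 = kahler_form E1 X - c * metric E2 X ->
  (1 - c ^+ 2) * f2 = kahler_form E2 X + c * metric E1 X ->
  let U := a1 *: E1 + a2 *: E2 in let V := b1 *: E1 + b2 *: E2 in
  gram_det U V * ((1 - c ^+ 2) * (a1 * f1 + a2 * f2)) =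
  gram_det U V * kahler_form U X
  - kahler_form U V * (metric U U * metric V X - metric U V * metric U X).
Proof.
move=> E11 E22 E12 K F1 F2 U V.
have -> : (1 - c ^+ 2) * (a1 * f1 + a2 * f2) =
    a1 * ((1 - c ^+ 2) * f1) + a2 * ((1 - c ^+ 2) * f2) by ring.
rewrite {}F1 {}F2 /gram_det {}/U {}/V.
rewrite !metricDl !metricDr !metricZl !metricZr.
rewrite !kahler_formDl !kahler_formDr !kahler_formZl !kahler_formZr.
rewrite !kahler_form0 (kahler_formC E2 E1) (metricC E2 E1) E11 E22 E12 K.
ring.
Qed.

Lemma kahler_form_span P Q (u v : 'rV[R]_2) :
  kahler_form (u 0 0 *: P + u 0 1 *: Q) (v 0 0 *: P + v 0 1 *: Q) =
  (u 0 0 * v 0 1 - u 0 1 * v 0 0) * kahler_form P Q.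
Proof. by rewrite !kahler_formE !mxE; ring. Qed.

Lemma gram_det_span P Q (u v : 'rV[R]_2) :
  gram_det (u 0 0 *: P + u 0 1 *: Q) (v 0 0 *: P + v 0 1 *: Q) =
  (u 0 0 * v 0 1 - u 0 1 * v 0 0) ^+ 2 * gram_det P Q.
Proof.
rewrite /gram_det !metricDl !metricDr !metricZl !metricZr (metricC Q P); ring.
Qed.

Lemma re_vol_span P Q (u v : 'rV[R]_2) :
  re_vol (u 0 0 *: P + u 0 1 *: Q) (v 0 0 *: P + v 0 1 *: Q) =
  (u 0 0 * v 0 1 - u 0 1 * v 0 0) * re_vol P Q.
Proof. by rewrite /re_vol !mxE; ring. Qed.

Lemma im_vol_span P Q (u v : 'rV[R]_2) :
  im_vol (u 0 0 *: P + u 0 1 *: Q) (v 0 0 *: P + v 0 1 *: Q) =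
  (u 0 0 * v 0 1 - u 0 1 * v 0 0) * im_vol P Q.
Proof. by rewrite /im_vol !mxE; ring. Qed.

Lemma re_vol_span_derive P Q P' Q' (u v : 'rV[R]_2) :
  re_vol (u 0 0 *: P' + u 0 1 *: Q') (v 0 0 *: P + v 0 1 *: Q) +
  re_vol (u 0 0 *: P + u 0 1 *: Q) (v 0 0 *: P' + v 0 1 *: Q') =
  (u 0 0 * v 0 1 - u 0 1 * v 0 0) * (re_vol P' Q + re_vol P Q').
Proof. by rewrite /re_vol !mxE; ring. Qed.

Lemma im_vol_span_derive P Q P' Q' (u v : 'rV[R]_2) :
  im_vol (u 0 0 *: P' + u 0 1 *: Q') (v 0 0 *: P + v 0 1 *: Q) +
  im_vol (u 0 0 *: P + u 0 1 *: Q) (v 0 0 *: P' + v 0 1 *: Q') =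
  (u 0 0 * v 0 1 - u 0 1 * v 0 0) * (im_vol P' Q + im_vol P Q').
Proof. by rewrite /im_vol !mxE; ring. Qed.

Lemma re_vol_direction P Q P0 P1 Q0 Q1 a b :
  re_vol (a *: P0 + b *: P1) Q + re_vol P (a *: Q0 + b *: Q1) =
  a * (re_vol P0 Q + re_vol P Q0) + b * (re_vol P1 Q + re_vol P Q1).
Proof. by rewrite /re_vol !mxE; ring. Qed.

Lemma im_vol_direction P Q P0 P1 Q0 Q1 a b :
  im_vol (a *: P0 + b *: P1) Q + im_vol P (a *: Q0 + b *: Q1) =
  a * (im_vol P0 Q + im_vol P Q0) + b * (im_vol P1 Q + im_vol P Q1).
Proof. by rewrite /im_vol !mxE; ring. Qed.

(** Under a change of the frame by constant coefficients both sides are multiplied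
    by the square of the determinant. *)
Lemma angle_derivative_span P Q P0 P1 Q0 Q1 (f0 f1 : R) (u v w : 'rV[R]_2) :
  let n := re_vol P Q ^+ 2 + im_vol P Q ^+ 2 in
  n * f0 = im_vol P Q * (re_vol P0 Q + re_vol P Q0)
           - re_vol P Q * (im_vol P0 Q + im_vol P Q0) ->
  n * f1 = im_vol P Q * (re_vol P1 Q + re_vol P Q1)
           - re_vol P Q * (im_vol P1 Q + im_vol P Q1) ->
  let span (S T : C2 R) (z : 'rV[R]_2) := z 0 0 *: S + z 0 1 *: T in
  let P' := span P0 P1 w in let Q' := span Q0 Q1 w in
  let A := re_vol (span P Q u) (span P Q v) in
  let B := im_vol (span P Q u) (span P Q v) in
  (A ^+ 2 + B ^+ 2) * (w 0 0 * f0 + w 0 1 * f1) =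
  B * (re_vol (span P' Q' u) (span P Q v) + re_vol (span P Q u) (span P' Q' v))
  - A * (im_vol (span P' Q' u) (span P Q v) + im_vol (span P Q u) (span P' Q' v)).
Proof.
move=> n H0 H1 span P' Q' A B; rewrite /A /B /span re_vol_span im_vol_span.
rewrite re_vol_span_derive im_vol_span_derive re_vol_direction im_vol_direction.
set d := _ - _.
transitivity (d ^+ 2 * (w 0 0 * (n * f0) + w 0 1 * (n * f1))).
  by rewrite /n; ring.
by rewrite H0 H1; ring.
Qed.

(** Gram-Schmidt, in coordinates with respect to [P, Q]; the positive
    orientation keeps the sign of [c]. *)
Lemma gram_schmidt P Q (c : R) : 0 < gram_det P Q ->
  kahler_form P Q = c * Num.sqrt (gram_det P Q) ->
  exists u v : 'rV[R]_2,
    let E1 := u 0 0 *: P + u 0 1 *: Q in let E2 := v 0 0 *: P + v 0 1 *: Q in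
    [/\ metric E1 E1 = 1, metric E2 E2 = 1, metric E1 E2 = 0,
        kahler_form E1 E2 = c & forall w, exists a b, w = a *: u + b *: v].
Proof.
set D := gram_det P Q => D0; set d := Num.sqrt D => K.
have g0 : 0 < metric P P.
  rewrite lt_neqAle eq_sym metric_ge0 andbT; apply/eqP => g0.
  by move: D0; rewrite /D /gram_det g0 mul0r sub0r oppr_gt0 ltNge sqr_ge0.
set n := Num.sqrt (metric P P).
have n0 : n != 0 by rewrite gt_eqF // sqrtr_gt0.
have d0 : d != 0 by rewrite gt_eqF // sqrtr_gt0.
have nn : metric P P = n ^+ 2 by rewrite sqr_sqrtr // ltW.
have dd : n ^+ 2 * metric Q Q = d ^+ 2 + metric P Q ^+ 2.
  by rewrite -nn sqr_sqrtr ?ltW // /D /gram_det subrK.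
pose u : 'rV[R]_2 := \row_a (if a == 0 then n^-1 else 0).
pose v : 'rV[R]_2 := \row_a (if a == 0 then - metric P Q / (n * d) else n / d).
exists u, v; rewrite /= !mxE /= scale0r addr0.
rewrite !(metricDl, metricDr) !(metricZl, metricZr).
rewrite !(kahler_formDr) !(kahler_formZl, kahler_formZr) kahler_form0 K.
rewrite (metricC Q P) nn; split.
- by field.
- transitivity ((n ^+ 2 * metric Q Q - metric P Q ^+ 2) / d ^+ 2).
    by field; rewrite n0 d0.
  by rewrite dd; field.
- by field; rewrite n0 d0.
- by field; rewrite n0 d0.
- move=> w; exists (n * w 0 0 + w 0 1 * metric P Q / n), (w 0 1 * d / n).
  by apply/rowP => i; rewrite !mxE; case: (ord2P i) => -> /=;
    field; rewrite n0 d0.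
Qed.

(** The derivative of the identity of [maslov_any_frame] in a direction in which
    [f], [X], [e1], [e2] have the derivatives [f'], [T], [w1], [w2]; here [f] is
    the derivative of the function in the direction of [e1]. *)
Definition maslov_derivative_rule (c f f' : R) (X e1 e2 w1 w2 T : C2 R) :=
  let D := gram_det e1 e2 in
  let D' := 2 * (metric w1 e1 * metric e2 e2 + metric e1 e1 * metric w2 e2
    - metric e1 e2 * (metric w1 e2 + metric e1 w2)) in
  let k := kahler_form e1 e2 in
  let k' := kahler_form w1 e2 + kahler_form e1 w2 in
  D * ((1 - c ^+ 2) * f') + (1 - c ^+ 2) * f * D' =
  D * (kahler_form w1 X + kahler_form e1 T) + kahler_form e1 X * D'
  - (k * (metric e1 e1 * (metric w2 X + metric e2 T)
          + metric e2 X * (2 * metric w1 e1)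
          - (metric e1 e2 * (metric w1 X + metric e1 T)
             + metric e1 X * (metric w1 e2 + metric e1 w2)))
     + (metric e1 e1 * metric e2 X - metric e1 e2 * metric e1 X) * k').

(** With [a - metric X E1] and [b - metric X E2] the tangential components of
    [W11 + W22], the conclusion is [Delta f = <X, grad f>]. The terms in the first
    derivatives of the metric cancel, and what remains is the pairing
    [kahler_form (W11 + W22) X], to which the summand [- X] of the trace does not
    contribute since the Kaehler form is alternating. *)
Lemma drift_laplacian (X E1 E2 W11 W12 W22 : C2 R) (c f1 f2 f11 f22 a b : R) :
  metric E1 E1 = 1 -> metric E2 E2 = 1 -> metric E1 E2 = 0 ->
  kahler_form E1 E2 = c ->
  kahler_form W11 E2 + kahler_form E1 W12
    = c * (metric W11 E1 + metric W12 E2) ->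
  kahler_form W12 E2 + kahler_form E1 W22
    = c * (metric W12 E1 + metric W22 E2) ->
  (1 - c ^+ 2) * f1 = kahler_form E1 X - c * metric E2 X ->
  (1 - c ^+ 2) * f2 = kahler_form E2 X + c * metric E1 X ->
  maslov_derivative_rule c f1 f11 X E1 E2 W11 W12 E1 ->
  maslov_derivative_rule c f2 f22 X E2 E1 W22 W12 E2 ->
  W11 + W22 = a *: E1 + b *: E2 - X ->
  (1 - c ^+ 2) * (f11 + f22) = (1 - c ^+ 2) * (a * f1 + b * f2).
Proof.
move=> E11 E22 E12 K angle1 angle2 F1 F2.
have K' : kahler_form E2 E1 = - c by rewrite kahler_formC K.
have E21 : metric E2 E1 = 0 by rewrite metricC.
rewrite /maslov_derivative_rule /gram_det E11 E22 E12 E21 K K' !kahler_form0.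
rewrite (kahler_formC W22 E1) (kahler_formC E2 W12) angle1.
have -> : - kahler_form E1 W22 + - kahler_form W12 E2 =
    - (c * (metric W12 E1 + metric W22 E2)) by rewrite -angle2; ring.
rewrite (metricC E1 W12) (metricC E2 W12) => H1 H2 shrink.
have S1 : kahler_form (W11 + W22) X =
    a * kahler_form E1 X + b * kahler_form E2 X.
  rewrite shrink -scaleN1r !kahler_formDl !kahler_formZl kahler_form0; ring.
have S2 : metric (W11 + W22) E1 = a - metric E1 X.
  rewrite shrink -scaleN1r !metricDl !metricZl E11 E21 (metricC X); ring.
have S3 : metric (W11 + W22) E2 = b - metric E2 X.
  rewrite shrink -scaleN1r !metricDl !metricZl E12 E22 (metricC X); ring.
rewrite kahler_formDl in S1; rewrite metricDl in S2; rewrite metricDl in S3.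
have aE : a = metric W11 E1 + metric W22 E1 + metric E1 X.
  by rewrite S2 subrK.
have bE : b = metric W11 E2 + metric W22 E2 + metric E2 X.
  by rewrite S3 subrK.
have k1 : kahler_form E1 X = (1 - c ^+ 2) * f1 + c * metric E2 X.
  by rewrite F1 subrK.
have k2 : kahler_form E2 X = (1 - c ^+ 2) * f2 - c * metric E1 X.
  by rewrite F2 addrK.
have k11 : kahler_form W11 X = a * kahler_form E1 X + b * kahler_form E2 X
    - kahler_form W22 X by rewrite -S1 addrK.
rewrite k11 aE bE k1 k2 in H1; rewrite k2 in H2.
rewrite aE bE; lra.
Qed.

(** At a critical point of [e^(r / 2) + C F ^ 2 / 2], where [h] is the value of the
    exponential, [ti] are the products of the position with the frame and [xi] its
    products with the second derivatives. The two inequalities add up to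
    [h (2 - |X^perp| ^ 2) + C |grad F| ^ 2 <= 0]: the terms with [F] cancel by the
    drift equation and the criticality. As [|X^perp| ^ 2] is
    [(1 - c ^+ 2) |grad F| ^ 2], this leaves [2 h <= 0]. *)
Lemma maximum_contradiction (C F f1 f2 f11 f22 h c a b r t1 t2 k1 k2 x1 x2 : R) :
  0 < 1 - c ^+ 2 ->
  h * t1 + C * (F * f1) = 0 ->
  h * (1 + x1) + t1 * (h * t1) + C * (F * f11 + f1 * f1) <= 0 ->
  h * t2 + C * (F * f2) = 0 ->
  h * (1 + x2) + t2 * (h * t2) + C * (F * f22 + f2 * f2) <= 0 ->
  (1 - c ^+ 2) * h <= C -> 0 < h -> f11 + f22 = a * f1 + b * f2 ->
  (1 - c ^+ 2) * f1 = k1 - c * t2 -> (1 - c ^+ 2) * f2 = k2 + c * t1 ->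
  x1 + x2 = a * t1 + b * t2 - r ->
  r * (1 - c ^+ 2) = t1 ^+ 2 + k1 ^+ 2 + (t2 ^+ 2 + k2 ^+ 2)
    + 2 * c * (t1 * k2 - k1 * t2) ->
  False.
Proof.
move=> s0 cu du cv dv hC h0 drift F1 F2 trace gram.
have k1E : k1 = (1 - c ^+ 2) * f1 + c * t2 by rewrite F1 subrK.
have k2E : k2 = (1 - c ^+ 2) * f2 - c * t1 by rewrite F2 addrK.
have normal : r - t1 ^+ 2 - t2 ^+ 2 = (1 - c ^+ 2) * (f1 ^+ 2 + f2 ^+ 2).
  apply: (mulfI (lt0r_neq0 s0)); move: gram; rewrite k1E k2E; lra.
have sum_le0 := lerD du dv; rewrite addr0 in sum_le0.
have cross : C * (F * (f11 + f22)) = - (a * (h * t1) + b * (h * t2)).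
  have acu := congr1 (fun z => a * z) cu; have bcv := congr1 (fun z => b * z) cv.
  rewrite drift; lra.
have htrace := congr1 (fun z => h * z) trace.
have hnormal := congr1 (fun z => h * z) normal.
have : (C - (1 - c ^+ 2) * h) * (f1 ^+ 2 + f2 ^+ 2) + 2 * h <= 0 by lra.
apply/negP; rewrite -ltNge ltr_wpDl ?mulr_gt0 //.
by rewrite mulr_ge0 ?subr_ge0 // addr_ge0 ?sqr_ge0.
Qed.

Section Derivations.
Context {V0 : normedModType R}.
Variables (A B : V0 -> C2 R) (p w : V0) (A' B' : C2 R).
Hypotheses (dA : is_derive p w A A') (dB : is_derive p w B B').

Let dAc i j := (is_derive_mxP _ _ _ _).1 dA i j.
Let dBc i j := (is_derive_mxP _ _ _ _).1 dB i j.

Lemma is_derive_metric : is_derive p w (fun q => metric (A q) (B q))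
  (metric A' (B p) + metric (A p) B').
Proof.
have -> : (fun q => metric (A q) (B q)) = fun q =>
    A q 0 0 * B q 0 0 + A q 0 1 * B q 0 1 +
    (A q 1 0 * B q 1 0 + A q 1 1 * B q 1 1).
  by apply/funext => q; exact: metricE.
apply: is_derive_real_eq (is_deriveD_real
  (is_deriveD_real (is_deriveM_real (dAc 0 0) (dBc 0 0))
                   (is_deriveM_real (dAc 0 1) (dBc 0 1)))
  (is_deriveD_real (is_deriveM_real (dAc 1 0) (dBc 1 0))
                   (is_deriveM_real (dAc 1 1) (dBc 1 1)))) _.
rewrite !metricE; ring.
Qed.

Lemma is_derive_kahler_form : is_derive p w (fun q => kahler_form (A q) (B q))
  (kahler_form A' (B p) + kahler_form (A p) B').
Proof.
have -> : (fun q => kahler_form (A q) (B q)) = fun q =>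
    (A q 0 0 * B q 0 1 + -1 * (A q 0 1 * B q 0 0)) +
    (A q 1 0 * B q 1 1 + -1 * (A q 1 1 * B q 1 0)).
  by apply/funext => q; rewrite kahler_formE !mulN1r.
apply: is_derive_real_eq (is_deriveD_real
  (is_deriveD_real (is_deriveM_real (dAc 0 0) (dBc 0 1))
    (is_deriveZ_real (-1) (is_deriveM_real (dAc 0 1) (dBc 0 0))))
  (is_deriveD_real (is_deriveM_real (dAc 1 0) (dBc 1 1))
    (is_deriveZ_real (-1) (is_deriveM_real (dAc 1 1) (dBc 1 0))))) _.
rewrite !kahler_formE; ring.
Qed.

Lemma is_derive_re_vol : is_derive p w (fun q => re_vol (A q) (B q))
  (re_vol A' (B p) + re_vol (A p) B').
Proof.
apply: is_derive_real_eq (is_deriveB_real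
  (is_deriveB_real (is_deriveM_real (dAc 0 0) (dBc 1 0))
                   (is_deriveM_real (dAc 0 1) (dBc 1 1)))
  (is_deriveB_real (is_deriveM_real (dBc 0 0) (dAc 1 0))
                   (is_deriveM_real (dBc 0 1) (dAc 1 1)))) _.
rewrite /re_vol; ring.
Qed.

Lemma is_derive_im_vol : is_derive p w (fun q => im_vol (A q) (B q))
  (im_vol A' (B p) + im_vol (A p) B').
Proof.
apply: is_derive_real_eq (is_deriveB_real
  (is_deriveD_real (is_deriveM_real (dAc 0 0) (dBc 1 1))
                   (is_deriveM_real (dAc 0 1) (dBc 1 0)))
  (is_deriveD_real (is_deriveM_real (dBc 0 0) (dAc 1 1))
                   (is_deriveM_real (dBc 0 1) (dAc 1 0)))) _.
rewrite /im_vol; ring.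
Qed.
End Derivations.
End FrameAlgebra.

(** * Immersions of constant Kaehler angle *)

(** The hypothesis [angle_primitive] says that [- d F] is the differential of the
    argument of the complex number [re_vol + i * im_vol]. *)
Section LocalSurface.
Context {R : realType}.
Variables (U : set 'rV[R]_2) (Y : 'rV[R]_2 -> C2 R) (F : 'rV[R]_2 -> R).
Variable c : R.
Hypotheses (oU : open U) (sY : smooth_on U Y) (sF : smooth_on (W := R) U F).
Hypothesis gram_gt0 : forall q, U q ->
  0 < gram_det (partial 0 Y q) (partial 1 Y q).
Hypothesis kahler_angle_cst : forall q, U q ->
  kahler_form (partial 0 Y q) (partial 1 Y q) =
  c * Num.sqrt (gram_det (partial 0 Y q) (partial 1 Y q)).
Hypothesis angle_primitive : forall q k, U q ->
  let P := partial 0 Y q in let Q := partial 1 Y q in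
  let P' := partial k (partial 0 Y) q in let Q' := partial k (partial 1 Y) q in
  (re_vol P Q ^+ 2 + im_vol P Q ^+ 2) * partial k F q =
  im_vol P Q * (re_vol P' Q + re_vol P Q')
  - re_vol P Q * (im_vol P' Q + im_vol P Q').
Hypothesis shrinker : forall q, U q ->
  mean_curvature Y q = - normal_part Y q (Y q).

Implicit Types (u v w q : 'rV[R]_2).

Let E u q : C2 R := dir u Y q.
Let W u v q : C2 R := dir2 u v Y q.
Let f u q : R := dir u F q.

Let E_def u q : E u q = u 0 0 *: partial 0 Y q + u 0 1 *: partial 1 Y q.
Proof. exact: dirE. Qed.

Let f_def u q : f u q = u 0 0 * partial 0 F q + u 0 1 * partial 1 F q.
Proof. exact: dir_realE. Qed.

Let angle_primitive_dir u v w q : U q ->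
  (re_vol (E u q) (E v q) ^+ 2 + im_vol (E u q) (E v q) ^+ 2) * f w q =
  im_vol (E u q) (E v q) *
    (re_vol (W w u q) (E v q) + re_vol (E u q) (W w v q))
  - re_vol (E u q) (E v q) *
    (im_vol (W w u q) (E v q) + im_vol (E u q) (W w v q)).
Proof.
move=> Uq; rewrite /W (dir2_fullE w u) (dir2_fullE w v) !E_def f_def.
exact: angle_derivative_span (angle_primitive 0 Uq) (angle_primitive 1 Uq).
Qed.

Let kahler_sqr u v q : U q ->
  kahler_form (E u q) (E v q) ^+ 2 = c ^+ 2 * gram_det (E u q) (E v q).
Proof.
move=> Uq; rewrite !E_def kahler_form_span gram_det_span kahler_angle_cst //.
by rewrite !exprMn sqr_sqrtr ?ltW ?gram_gt0 //; ring.
Qed.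

Let is_derive_E u w q : U q -> is_derive q w (E u) (W w u q).
Proof. by move=> Uq; exact: is_derive_dir2 oU Uq sY. Qed.

Let is_derive_Y w q : U q -> is_derive q w Y (E w q).
Proof. by move=> Uq; exact: is_derive_dir oU Uq sY. Qed.

Let is_derive_f u w q : U q -> is_derive q w (f u) (dir2 w u F q).
Proof. by move=> Uq; exact: is_derive_dir2_real oU Uq sF. Qed.

Let is_derive_gram_det u v w q : U q ->
  is_derive q w (fun z => gram_det (E u z) (E v z))
   (2 * (metric (W w u q) (E u q) * metric (E v q) (E v q)
    + metric (E u q) (E u q) * metric (W w v q) (E v q)
    - metric (E u q) (E v q) *
      (metric (W w u q) (E v q) + metric (E u q) (W w v q)))).
Proof.
move=> Uq; have dE1 := is_derive_E u w Uq; have dE2 := is_derive_E v w Uq.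
have -> : (fun z => gram_det (E u z) (E v z)) = fun z =>
   metric (E u z) (E u z) * metric (E v z) (E v z) +
   -1 * (metric (E u z) (E v z) * metric (E u z) (E v z)).
  by apply/funext => z; rewrite /gram_det expr2 mulN1r.
have d12 := is_derive_metric dE1 dE2.
apply: is_derive_real_eq (is_deriveD_real (is_deriveM_real
  (is_derive_metric dE1 dE1) (is_derive_metric dE2 dE2))
  (is_deriveZ_real (-1) (is_deriveM_real d12 d12))) _.
by rewrite (metricC (W w u q) (E u q)) (metricC (W w v q) (E v q)); ring.
Qed.

Let is_derive_unique (g h : 'rV[R]_2 -> R) q w (a b : R) : U q ->
  (forall z, U z -> g z = h z) -> is_derive q w g a -> is_derive q w h b ->
  a = b.
Proof.
move=> Uq gh [_ <-] [_ <-]; apply: near_eq_derive.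
exact: near_open oU Uq gh.
Qed.

(** Differentiating the square of the equation defining the Kaehler angle avoids
    the root of the Gram determinant, but yields nothing where both sides vanish;
    for [c = 0] the Kaehler form itself is zero near [q]. *)
Let kahler_angle_derive u v w q : U q ->
  metric (E u q) (E u q) = 1 -> metric (E v q) (E v q) = 1 ->
  metric (E u q) (E v q) = 0 -> kahler_form (E u q) (E v q) = c ->
  kahler_form (W w u q) (E v q) + kahler_form (E u q) (W w v q) =
  c * (metric (W w u q) (E u q) + metric (W w v q) (E v q)).
Proof.
move=> Uq E11 E22 E12 K.
have dK := is_derive_kahler_form (is_derive_E u w Uq) (is_derive_E v w Uq).
have [c0|c0] := eqVneq c 0.
  rewrite c0 mul0r.
  apply: (is_derive_unique Uq _ dK (is_derive_cst_real q w 0)) => z Uz.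
  by apply/eqP; rewrite -sqrf_eq0 kahler_sqr // c0 expr0n mul0r.
have := is_derive_unique Uq (kahler_sqr u v) (is_deriveM_real dK dK)
  (is_deriveZ_real (c ^+ 2) (is_derive_gram_det u v w Uq)).
rewrite E11 E22 E12 K => H.
apply: (mulfI c0); apply: (@mulfI _ 2) => //.
by rewrite mulr2n mulrDl mul1r [LHS]H; ring.
Qed.

Let orthonormal_frame q : U q -> exists u v,
  [/\ metric (E u q) (E u q) = 1, metric (E v q) (E v q) = 1,
      metric (E u q) (E v q) = 0, kahler_form (E u q) (E v q) = c &
      forall w, exists a b, w = a *: u + b *: v].
Proof.
move=> Uq.
have [u [v H]] := gram_schmidt (gram_gt0 Uq) (kahler_angle_cst Uq).
by exists u, v; rewrite !E_def.
Qed.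

Let gram_frame (e : 'M[R]_2) q i j :
  (e *m gram Y q *m e^T) i j = metric (E (row i e) q) (E (row j e) q).
Proof.
rewrite !E_def mxE sum2E !mxE !sum2E !mxE; move: (partial 0 Y q) => P.
move: (partial 1 Y q) => Q.
rewrite !metricDl !metricDr !metricZl !metricZr; ring.
Qed.

Let tangent_span u v q V : (forall w, exists a b, w = a *: u + b *: v) ->
  exists a b, tangent_part Y q V = a *: E u q + b *: E v q.
Proof.
move=> uv.
have EP (k : 'I_2) : exists a b, partial k Y q = a *: E u q + b *: E v q.
  have [a [b ek]] := uv 'e_k; exists a, b.
  have -> : partial k Y q = E 'e_k q.
    rewrite E_def !mxE.
    by case: (ord2P k) => -> /=; rewrite !(scale0r, scale1r) ?addr0 ?add0r.
  rewrite ek !E_def !mxE; move: (partial 0 Y q) (partial 1 Y q) => P Q.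
  by rewrite !scalerDr !scalerDl !scalerA addrACA.
have [a0 [b0 P0]] := EP 0; have [a1 [b1 P1]] := EP 1.
have [x [y ->]] : exists x y,
    tangent_part Y q V = x *: partial 0 Y q + y *: partial 1 Y q.
  rewrite /tangent_part exchange_big sum2E.
  by do 2 eexists; congr (_ + _); rewrite -scaler_suml.
rewrite P0 P1; exists (x * a0 + y * a1), (x * b0 + y * b1).
by rewrite !scalerDr !scalerDl !scalerA addrACA.
Qed.

Let shrinker_frame u v q : U q ->
  metric (E u q) (E u q) = 1 -> metric (E v q) (E v q) = 1 ->
  metric (E u q) (E v q) = 0 ->
  (forall w, exists a b, w = a *: u + b *: v) ->
  exists a b, W u u q + W v v q = a *: E u q + b *: E v q - Y q.
Proof.
move=> Uq E11 E22 E12 uv.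
pose e : 'M[R]_2 := \matrix_(k, a) (if k == 0 then u 0 a else v 0 a).
have e0 : row 0 e = u by apply/rowP => i; rewrite !mxE.
have e1 : row 1 e = v by apply/rowP => i; rewrite !mxE.
have /mean_curvature_frame : e *m gram Y q *m e^T = 1%:M.
  apply/matrixP => i j; rewrite gram_frame mxE.
  by case: (ord2P i) => ->; case: (ord2P j) => ->;
    rewrite ?e0 ?e1 ?E11 ?E22 ?E12 // metricC E12.
rewrite sum2E e0 e1 shrinker // /second_fundamental_form /normal_part.
rewrite -/(dir2 u u Y q) -/(dir2 v v Y q) -/(W u u q) -/(W v v q).
have [a1 [b1 ->]] := tangent_span q (W u u q) uv.
have [a2 [b2 ->]] := tangent_span q (W v v q) uv.
have [a3 [b3 ->]] := tangent_span q (Y q) uv.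
move: (E u q) (E v q) (Y q) (W u u q) (W v v q) => P Q X W1 W2 H.
exists (a1 + a2 + a3), (b1 + b2 + b3).
have -> : W1 + W2 = (W1 - (a1 *: P + b1 *: Q) + (W2 - (a2 *: P + b2 *: Q)))
   + (a1 *: P + b1 *: Q) + (a2 *: P + b2 *: Q).
  by apply/matrixP => i j; rewrite !mxE; ring.
by rewrite -H; apply/matrixP => i j; rewrite !mxE; ring.
Qed.

(** The frame is made of constant directions, chosen according to [q]. *)
Let frame_formula q : U q -> exists u v,
  [/\ [/\ metric (E u q) (E u q) = 1, metric (E v q) (E v q) = 1,
      metric (E u q) (E v q) = 0 & kahler_form (E u q) (E v q) = c],
      (1 - c ^+ 2) * f u q = kahler_form (E u q) (Y q) - c * metric (E v q) (Y q),
      (1 - c ^+ 2) * f v q = kahler_form (E v q) (Y q) + c * metric (E u q) (Y q),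
      exists a b, W u u q + W v v q = a *: E u q + b *: E v q - Y q &
      forall w, exists a b, w = a *: u + b *: v].
Proof.
move=> Uq; have [u [v [E11 E22 E12 K uv]]] := orthonormal_frame Uq.
have [a [b shr]] := shrinker_frame Uq E11 E22 E12 uv.
have Wvu : W v u q = W u v q by exact: dir2C oU Uq sY.
have an1 := kahler_angle_derive u Uq E11 E22 E12 K.
have an2 := kahler_angle_derive v Uq E11 E22 E12 K.
have ap1 := angle_primitive_dir u v u Uq.
have ap2 := angle_primitive_dir u v v Uq.
rewrite Wvu in an2 ap2.
have [F1 F2] := maslov_frame E11 E22 E12 K an1 an2 ap1 ap2 shr.
by exists u, v; split=> //; exists a, b.
Qed.

Let maslov_formula q u v : U q ->
  gram_det (E u q) (E v q) * ((1 - c ^+ 2) * f u q) =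
  gram_det (E u q) (E v q) * kahler_form (E u q) (Y q)
  - kahler_form (E u q) (E v q) *
    (metric (E u q) (E u q) * metric (E v q) (Y q)
     - metric (E u q) (E v q) * metric (E u q) (Y q)).
Proof.
move=> Uq; have [u0 [v0 [[E11 E22 E12 K] F1 F2 _ uv]]] := frame_formula Uq.
have [a1 [a2 ua]] := uv u; have [b1 [b2 vb]] := uv v.
have lin a b : E (a *: u0 + b *: v0) q = a *: E u0 q + b *: E v0 q.
  rewrite !E_def !mxE; move: (partial 0 Y q) (partial 1 Y q) => P Q.
  by rewrite !scalerDr !scalerDl !scalerA addrACA.
have flin a b : f (a *: u0 + b *: v0) q = a * f u0 q + b * f v0 q.
  by rewrite !f_def !mxE; ring.
rewrite ua vb !lin flin.
exact: maslov_any_frame E11 E22 E12 K F1 F2.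
Qed.

Let maslov_formula_derive u v w q : U q ->
  maslov_derivative_rule c (f u q) (dir2 w u F q) (Y q)
    (E u q) (E v q) (W w u q) (W w v q) (E w q).
Proof.
move=> Uq D D' k k'.
have d1 := is_derive_E u w Uq; have d2 := is_derive_E v w Uq.
have dX := is_derive_Y w Uq; have dD := is_derive_gram_det u v w Uq.
have := is_derive_unique Uq (fun z Uz => maslov_formula u v Uz)
  (is_deriveM_real dD (is_deriveZ_real (1 - c ^+ 2) (is_derive_f u w Uq)))
  (is_deriveB_real (is_deriveM_real dD (is_derive_kahler_form d1 dX))
    (is_deriveM_real (is_derive_kahler_form d1 d2)
      (is_deriveB_real (is_deriveM_real (is_derive_metric d1 d1) (is_derive_metric d2 dX))
         (is_deriveM_real (is_derive_metric d1 d2) (is_derive_metric d1 dX))))).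
rewrite (metricC (E u q) (W w u q)) => H.
by rewrite /D /D' /k /k' H; ring.
Qed.

(** The mean curvature enters twice: the second derivatives of the exponential
    contain [<Y, H>], and those of [F] are governed by the drift equation. *)
Lemma no_local_maximum (C : R) p : U p -> 0 < 1 - c ^+ 2 ->
  (1 - c ^+ 2) * expR (2^-1 * metric (Y p) (Y p)) <= C ->
  ~ (forall q, U q ->
       expR (2^-1 * metric (Y q) (Y q)) + 2^-1 * C * (F q * F q) <=
       expR (2^-1 * metric (Y p) (Y p)) + 2^-1 * C * (F p * F p)).
Proof.
move=> Up s0 Cp gmax.
pose g q := expR (2^-1 * metric (Y q) (Y q)) + 2^-1 * C * (F q * F q).
have [u [v [[E11 E22 E12 K] F1 F2 [a [b shr]] _]]] := frame_formula Up.
have Wvu : W v u p = W u v p by exact: dir2C oU Up sY.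
have an1 := kahler_angle_derive u Up E11 E22 E12 K.
have an2 := kahler_angle_derive v Up E11 E22 E12 K.
have H1 := maslov_formula_derive u v u Up.
have H2 := maslov_formula_derive v u v Up.
rewrite Wvu in an2 H2.
have drift := drift_laplacian E11 E22 E12 K an1 an2 F1 F2 H1 H2 shr.
have {}drift := mulfI (lt0r_neq0 s0) drift.
pose h q := expR (2^-1 * metric (Y q) (Y q)).
have dh w q : U q -> is_derive q w h (h q * metric (Y q) (E w q)).
  move=> Uq; have dY := is_derive_Y w Uq.
  apply: is_derive_real_eq (is_derive_chain
    (is_deriveZ_real 2^-1 (is_derive_metric dY dY)) (is_derive_expR _)) _.
  by rewrite /h (metricC (E w q)); field.
have dg w q : U q ->
    is_derive q w g (h q * metric (Y q) (E w q) + C * (F q * f w q)).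
  move=> Uq; have dF := is_derive_dir_real w oU Uq sF.
  apply: is_derive_real_eq (is_deriveD_real (dh w q Uq)
    (is_deriveZ_real (2^-1 * C) (is_deriveM_real dF dF))) _.
  by rewrite /f; field.
have crit w := second_derivative_test (open_nbhs_nbhs (conj oU Up)) (dg w)
  (is_deriveD_real
    (is_deriveM_real (dh w p Up)
       (is_derive_metric (is_derive_Y w Up) (is_derive_E w w Up)))
    (is_deriveZ_real C
       (is_deriveM_real (is_derive_dir_real w oU Up sF) (is_derive_f w w Up))))
  gmax.
have [cu du] := crit u; have [cv dv] := crit v.
have h0 : 0 < h p by exact: expR_gt0.
have := hermitian_gram0 (E u p) (E v p) (Y p).
have := congr1 (metric (Y p)) shr.
rewrite -scaleN1r !metricDr !metricZr mulN1r.
move: cu du cv dv Cp h0 drift F1 F2.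
rewrite -/(h p) (metricC (E u p) (Y p)) (metricC (E v p) (Y p)) E11 E22 E12 K.
rewrite !mul1r expr0n !subr0 mulr0 mul0r subr0.
exact: maximum_contradiction s0.
Qed.
End LocalSurface.

(** * Local lifts of the Lagrangian angle *)

Section AngleLift.
Context {R : realType}.
Implicit Types (U : set 'rV[R]_2) (A B : 'rV[R]_2 -> R).

Lemma unit_circle_angle (x y : R) : x ^+ 2 + y ^+ 2 = 1 ->
  exists b, cos b = x /\ sin b = y.
Proof.
move=> xy.
have x1 : -1 <= x <= 1.
  rewrite -ler_norml -(@ler_pXn2r _ 2) ?nnegrE // expr1n -normrX.
  by rewrite ger0_norm ?sqr_ge0 // -xy lerDl sqr_ge0.
have sx : Num.sqrt (1 - x ^+ 2) = `|y| by rewrite -xy addrC addKr sqrtr_sqr.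
have [y0|y0] := leP 0 y.
  by exists (acos x); rewrite acosK ?in_itv //= sin_acos // sx ger0_norm.
exists (- acos x); rewrite cosN sinN acosK ?in_itv //= sin_acos // sx.
by rewrite ltr0_norm // opprK.
Qed.

Lemma cos_atan_div (x y : R) : 0 < x ->
  cos (atan (y / x)) = x / Num.sqrt (x ^+ 2 + y ^+ 2).
Proof.
move=> x0; rewrite cos_atan.
have -> : 1 + (y / x) ^+ 2 = (x ^+ 2 + y ^+ 2) / x ^+ 2.
  by field; rewrite gt_eqF.
rewrite sqrtrM ?addr_ge0 ?sqr_ge0 // sqrtrV ?sqr_ge0 // sqrtr_sqr gtr0_norm //.
by rewrite invfM invrK mulrC.
Qed.

Lemma sin_atan_div (x y : R) : 0 < x ->
  sin (atan (y / x)) = y / Num.sqrt (x ^+ 2 + y ^+ 2).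
Proof.
move=> x0; have := atanK (y / x); rewrite /tan => H.
have c0 : cos (atan (y / x)) != 0.
  by rewrite cos_atan invr_neq0 // gt_eqF // sqrtr_gt0 ltr_wpDr ?sqr_ge0.
rewrite -[LHS](divfK c0) H cos_atan_div //.
by rewrite mulrA divfK // gt_eqF.
Qed.

(** After a rotation sending the point [(A q, B q)] to the positive real axis,
    the argument is an arctangent near [q]. *)
Lemma local_angle_lift U A B q : open U -> U q ->
  smooth_on (W := R) U A -> smooth_on (W := R) U B ->
  0 < A q ^+ 2 + B q ^+ 2 ->
  exists U0 b, [/\ [/\ open U0, U0 q & U0 `<=` U], smooth_on (W := R) U0 b,
    forall z, U0 z ->
      cos (b z) = A z / Num.sqrt (A z ^+ 2 + B z ^+ 2) /\
      sin (b z) = B z / Num.sqrt (A z ^+ 2 + B z ^+ 2) &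
    forall w (A' B' : R), is_derive q w A A' -> is_derive q w B B' ->
      is_derive q w b ((A q * B' - B q * A') / (A q ^+ 2 + B q ^+ 2))].
Proof.
move=> oU Uq sA sB n0; set n := A q ^+ 2 + B q ^+ 2 in n0 *.
set r := Num.sqrt n.
have r0 : 0 < r by rewrite sqrtr_gt0.
have rr : r ^+ 2 = n by rewrite sqr_sqrtr // ltW.
have rN : r != 0 by rewrite gt_eqF.
have [b0 [cb0 sb0]] : exists b, cos b = A q / r /\ sin b = B q / r.
  apply: unit_circle_angle; rewrite !expr_div_n -mulrDl rr divff //.
  by rewrite gt_eqF.
pose x z := cos b0 * A z + sin b0 * B z.
pose y z := cos b0 * B z - sin b0 * A z.
have xq : x q = r.
  rewrite /x cb0 sb0 -[RHS](mulfK rN) -expr2 rr /n; field; exact: rN.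
have yq : y q = 0 by rewrite /y cb0 sb0; ring.
have xy z : x z ^+ 2 + y z ^+ 2 = A z ^+ 2 + B z ^+ 2.
  transitivity ((cos b0 ^+ 2 + sin b0 ^+ 2) * (A z ^+ 2 + B z ^+ 2)).
    by rewrite /x /y; ring.
  by rewrite cos2Dsin2 mul1r.
have ex N : open N -> N `<=` U -> smooth_expr N x /\ smooth_expr N y.
  move=> oN NU.
  have eA : smooth_expr N A by apply: smooth_expr_base => s z /NU; exact: sA.
  have eB : smooth_expr N B by apply: smooth_expr_base => s z /NU; exact: sB.
  by split; [apply: smooth_exprD | apply: smooth_exprB];
    apply: smooth_exprM => //; exact: smooth_expr_cst.
have cx : {for q, continuous x}.
  by have [ex_ _] := ex U oU (@subset_refl _ U);
    exact: (smooth_expr_derive oU ex_).1.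
have : \forall z \near q, U z /\ 0 < x z.
  apply: filterI; first exact: open_nbhs_nbhs.
  by move: cx => /cvgr_gt; apply; rewrite xq.
rewrite -nbhs_nearE nbhsE /= => -[N [oN Nq] NU].
have [exx exy] := ex N oN (fun z Nz => (NU z Nz).1).
exists N, (fun z => b0 + atan (y z / x z)); split.
- by split=> // z /NU[].
- apply: smooth_expr_smooth => //; apply: smooth_exprD.
    exact: smooth_expr_cst.
  apply: smooth_expr_atan; apply: smooth_exprM => //; apply: smooth_exprV => //.
  by move=> z /NU[_ xz]; rewrite gt_eqF.
- move=> z /NU[Uz xz].
  rewrite cosD sinD cos_atan_div // sin_atan_div // xy.
  have E := cos2Dsin2 b0.
  split.
    transitivity ((cos b0 ^+ 2 + sin b0 ^+ 2) * A z / Num.sqrt (A z ^+ 2 + B z ^+ 2)).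
      by rewrite /x /y; ring.
    by rewrite E mul1r.
  transitivity ((cos b0 ^+ 2 + sin b0 ^+ 2) * B z / Num.sqrt (A z ^+ 2 + B z ^+ 2)).
    by rewrite /x /y; ring.
  by rewrite E mul1r.
- move=> w A' B' dA dB.
  have dx := is_deriveD_real (is_deriveZ_real (cos b0) dA)
    (is_deriveZ_real (sin b0) dB).
  have dy := is_deriveB_real (is_deriveZ_real (cos b0) dB)
    (is_deriveZ_real (sin b0) dA).
  have xq0 : x q != 0 by rewrite xq.
  apply: is_derive_real_eq (is_deriveD_real (is_derive_cst_real q w b0)
    (is_derive_chain (is_deriveM_real dy (is_deriveV_real xq0 dx))
       (is_derive1_atan _))) _.
  rewrite -/(x q) -/(y q) xq yq cb0 sb0 -rr; field.
  exact: rN.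
Qed.
End AngleLift.

(** * The Maslov form in a chart *)

Section LagrangianAngle.
Context {R : realType}.
Variables (U : set 'rV[R]_2) (Y : 'rV[R]_2 -> C2 R).
Hypotheses (oU : open U) (sY : smooth_on U Y).

Lemma det_gram p : \det (gram Y p) = gram_det (partial 0 Y p) (partial 1 Y p).
Proof.
rewrite (expand_det_row _ 0) sum2E /cofactor !det_mx11 !mxE /=.
have -> : lift 0 0 = 1 :> 'I_2 by exact/val_inj.
have -> : lift 1 0 = 0 :> 'I_2 by exact/val_inj.
move: (partial 0 Y p) (partial 1 Y p) => P Q.
by rewrite /gram_det (metricC Q P) expr0 expr1; ring.
Qed.

(** If the Gram determinant vanishes, the combination of the tangent vectors given
    by a row of the adjugate Gram matrix has length zero. *)
Lemma gram_det_gt0 p : immersive Y p ->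
  0 < gram_det (partial 0 Y p) (partial 1 Y p).
Proof.
move=> imm.
have {}imm (u : 'rV[R]_2) :
    u 0 0 *: partial 0 Y p + u 0 1 *: partial 1 Y p = 0 -> u = 0.
  by move=> H; apply: imm; rewrite sum2E.
move: (partial 0 Y p) (partial 1 Y p) imm => P Q imm.
have D0 : 0 <= gram_det P Q.
  have := norm_vol P Q; rewrite -/(gram_det P Q) => /eqP.
  rewrite eq_sym subr_eq => /eqP ->.
  by rewrite !addr_ge0 ?sqr_ge0.
rewrite lt_neqAle D0 andbT; apply/eqP => /esym D00.
have eq0 (a b : R) : metric (a *: P + b *: Q) (a *: P + b *: Q) = 0 ->
    a = 0 /\ b = 0.
  move=> /metric_eq0 H.
  have := imm (\row_k (if k == 0 then a else b)); rewrite !mxE /= => /(_ H) E.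
  by split; [move/rowP/(_ 0): E | move/rowP/(_ 1): E]; rewrite !mxE.
have [|_ PP] := eq0 (- metric P Q) (metric P P).
  transitivity (metric P P * gram_det P Q); last by rewrite D00 mulr0.
  rewrite !(metricDl, metricDr) !(metricZl, metricZr) (metricC Q P) /gram_det.
  ring.
have [|/eqP] := eq0 1 0; last by rewrite oner_eq0.
by rewrite scale1r scale0r addr0.
Qed.

Lemma lagrangian_angleP p b :
  0 < gram_det (partial 0 Y p) (partial 1 Y p) ->
  let A := re_vol (partial 0 Y p) (partial 1 Y p) in
  let B := im_vol (partial 0 Y p) (partial 1 Y p) in
  0 < A ^+ 2 + B ^+ 2 ->
  cos b = A / Num.sqrt (A ^+ 2 + B ^+ 2) ->
  sin b = B / Num.sqrt (A ^+ 2 + B ^+ 2) ->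
  lagrangian_angle Y p b.
Proof.
move=> D0 A B AB0 cb sb; rewrite /lagrangian_angle /= /eta holomorphic_volumeE.
rewrite -/A -/B /area_density det_gram.
set d := Num.sqrt _; have d0 : 0 < d by rewrite sqrtr_gt0.
have dN : d != 0 by rewrite gt_eqF.
have -> : ((A +i* B) / d%:C)%C = ((A / d) +i* (B / d))%C.
  by apply/eqP; rewrite eq_complex /= expr0n addr0 mul0r oppr0 !mulr0 subr0 add0r;
    apply/andP; split; apply/eqP; field.
have -> : `|((A / d) +i* (B / d))%C| =
    (Num.sqrt ((A / d) ^+ 2 + (B / d) ^+ 2))%:C%C by [].
rewrite !expr_div_n -mulrDl sqrtrM ?addr_ge0 ?sqr_ge0 // sqrtrV ?sqr_ge0 //.
rewrite sqrtr_sqr gtr0_norm // cb sb.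
have n0 : Num.sqrt (A ^+ 2 + B ^+ 2) != 0.
  by rewrite gt_eqF // sqrtr_gt0.
by apply/eqP; rewrite eq_complex /= !mul0r subr0 addr0;
  apply/andP; split; apply/eqP; field; rewrite n0 dN.
Qed.

Let smooth_expr_partial_coord k i j :
  smooth_expr U (fun q => partial k Y q i j).
Proof.
exact: (smooth_expr_base (smooth_on_coord i j oU (smooth_on_partial k sY))).
Qed.

Lemma smooth_re_vol : smooth_on (W := R) U
  (fun q => re_vol (partial 0 Y q) (partial 1 Y q)).
Proof.
apply: smooth_expr_smooth => //; apply: smooth_exprB; apply: smooth_exprB;
  by apply: smooth_exprM; exact: smooth_expr_partial_coord.
Qed.

Lemma smooth_im_vol : smooth_on (W := R) U
  (fun q => im_vol (partial 0 Y q) (partial 1 Y q)).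
Proof.
apply: smooth_expr_smooth => //; apply: smooth_exprB; apply: smooth_exprD;
  by apply: smooth_exprM; exact: smooth_expr_partial_coord.
Qed.

End LagrangianAngle.

Section AngleForm.
Context {R : realType} (M : oriented_surface R) (x : M -> C2 R).
Variables (theta : R) (alpha : closed_form M) (i : chart_index M).
Hypotheses (x_immersion : immersion x).
Hypotheses (theta_range : 0 < theta < pi).
Hypotheses (x_angle : has_constant_kahler_angle x theta).
Hypothesis alpha_maslov : is_maslov_form x alpha.

Let U := chart_cod i.
Let Y := x \o @param _ M i.

Lemma chart_gram_gt0 q : U q -> 0 < gram_det (partial 0 Y q) (partial 1 Y q).
Proof. by move=> Uq; apply: gram_det_gt0; exact: x_immersion.2. Qed.

Lemma chart_kahler_angle q : U q ->
  kahler_form (partial 0 Y q) (partial 1 Y q) =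
  cos theta * Num.sqrt (gram_det (partial 0 Y q) (partial 1 Y q)).
Proof.
move=> Uq; have D0 := chart_gram_gt0 Uq.
rewrite -(x_angle Uq) /kahler_angle /area_density det_gram.
rewrite -/Y; move: (partial 0 Y q) (partial 1 Y q) D0 => P Q D0.
have d0 : 0 < Num.sqrt (gram_det P Q) by rewrite sqrtr_gt0.
rewrite acosK ?divfK ?gt_eqF // in_itv /= -ler_norml normrM normfV.
rewrite (gtr0_norm d0) ler_pdivrMr // mul1r.
rewrite -sqrtr_sqr ler_wsqrtr //.
have := norm_vol P Q; rewrite -/(gram_det P Q) => H.
by rewrite -subr_ge0 -H addr_ge0 ?sqr_ge0.
Qed.

Lemma sqr_cos_lt1 : 0 < 1 - cos theta ^+ 2.
Proof. by rewrite -sin2cos2 exprn_gt0 // sin_gt0_pi. Qed.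

Lemma vol_gt0 q : U q ->
  0 < re_vol (partial 0 Y q) (partial 1 Y q) ^+ 2
      + im_vol (partial 0 Y q) (partial 1 Y q) ^+ 2.
Proof.
move=> Uq; have D0 := chart_gram_gt0 Uq.
rewrite norm_vol -/(gram_det _ _) chart_kahler_angle //.
rewrite exprMn sqr_sqrtr ?ltW // -[X in X - _]mul1r -mulrBl mulr_gt0 //.
exact: sqr_cos_lt1.
Qed.

(** The hypothesis on [alpha] is applied to the lift of [local_angle_lift], whose
    derivative at [q] is explicit. *)
Lemma maslov_formE q k : U q ->
  let P := partial 0 Y q in let Q := partial 1 Y q in
  let P' := partial k (partial 0 Y) q in let Q' := partial k (partial 1 Y) q in
  (re_vol P Q ^+ 2 + im_vol P Q ^+ 2) * alpha i q k 0 =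
  im_vol P Q * (re_vol P' Q + re_vol P Q')
  - re_vol P Q * (im_vol P' Q + im_vol P Q').
Proof.
move=> Uq P Q P' Q'; have oU : open U by exact: chart_cod_open.
have sY : smooth_on U Y by exact: x_immersion.1.
have n0 := vol_gt0 Uq.
have [U0 [b [[oU0 U0q U0U] sb cosin db]]] := local_angle_lift oU Uq
  (smooth_re_vol oU sY) (smooth_im_vol oU sY) n0.
have lift_b z : U0 z -> lagrangian_angle Y z (b z).
  move=> U0z; have [cb sb'] := cosin z U0z; have Uz := U0U z U0z.
  by apply: lagrangian_angleP cb sb'; [exact: chart_gram_gt0 | exact: vol_gt0].
have -> := alpha_maslov oU0 U0U sb lift_b U0q.
have dP := smooth_on_is_derive k (smooth_on_partial 0 sY) Uq.
have dQ := smooth_on_is_derive k (smooth_on_partial 1 sY) Uq.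
have [_ Eb] := db _ _ _ (is_derive_re_vol dP dQ) (is_derive_im_vol dP dQ).
rewrite mxE [X in _ * - X]mxE.
have -> : partial (W := R^o) k b q = 'D_'e_k b q by [].
rewrite Eb; move: n0; move: (re_vol _ Q + _) (im_vol _ Q + _) => A' B'.
by move: (re_vol _ _) (im_vol _ _) => A B n0; field; rewrite gt_eqF.
Qed.
End AngleForm.

(** * Functions on the surface *)

Section SurfaceFunctions.
Context {R : realType} (M : oriented_surface R).

Lemma smooth_continuous {W : normedModType R} (f : M -> W) :
  smooth f -> continuous f.
Proof.
move=> sf m; have [i mi] := chart_cover m.
have near_f : \forall z \near m, (f \o param i) (chart i z) = f z.
  apply: near_open (chart_dom_open i) mi _ => z zi /=.
  by rewrite chartK.
apply: near_eq_continuous near_f _.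
apply: (@continuous_comp _ _ _ (chart i) (f \o param i)).
  have := @chart_continuous _ M i.
  by rewrite continuous_open_subspace; [apply; exact/mem_set | exact: chart_dom_open].
by have [] := sf i [::] (chart i m) (chart_dom_cod mi).
Qed.

Lemma zero_exact : exact_form (fun (i : chart_index M) p => 0).
Proof.
have s0 (s : seq 'I_2) :
    foldr (partial (W := R^o)) (fun=> 0) s = fun=> 0.
  elim: s => //= k s ->; apply/funext => p; exact: derive_cst.
exists (fun=> 0).
  move=> i s p Ui; rewrite /comp s0.
  by split=> [|k]; [exact: cst_continuous | exact: derivable_cst].
move=> i p _; apply/matrixP => k j; rewrite !mxE.
by rewrite /partial /comp derive_cst.
Qed.

Lemma maximum_exists (g : M -> R) : compact [set: M] -> continuous g ->
  exists m, forall z, g z <= g m.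
Proof.
move=> cM cg.
have [m _ mmax] := compact_EVT_max (surface_nonempty M) cM
  (continuous_subspaceT cg).
by exists m => z; apply: mmax; rewrite inE.
Qed.

Lemma continuousM_real (f g : M -> R) : continuous f -> continuous g ->
  continuous (fun z => f z * g z).
Proof. by move=> cf cg z; exact: (continuousM (cf z) (cg z)). Qed.

Lemma continuousD_real (f g : M -> R) : continuous f -> continuous g ->
  continuous (fun z => f z + g z).
Proof. by move=> cf cg z; exact: (continuousD (cf z) (cg z)). Qed.

Lemma continuousZ_real (c : R) (f : M -> R) : continuous f ->
  continuous (fun z => c * f z).
Proof. by move=> cf; apply: continuousM_real => // z; exact: cst_continuous. Qed.

End SurfaceFunctions.

Theorem theorem1p3 (R : realType) (M : oriented_surface R) (x : M -> C2 R)
    (theta : R) (alpha : closed_form M)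
    (M_compact : compact [set: M])
    (x_immersion : immersion x)
    (x_shrinker : self_shrinker x)
    (theta_range : 0 < theta < pi)
    (x_angle : has_constant_kahler_angle x theta)
    (alpha_maslov : is_maslov_form x alpha) :
  de_rham_class alpha <> @de_rham_zero R M.
Proof.
move=> H.
(* [alpha] belongs to its own class, which is the zero class by [H]. *)
have [f sf df] : exact_form alpha.
  suff : de_rham_class alpha alpha by rewrite H.
  rewrite /de_rham_class /=.
  have [g sg dg] := zero_exact M; exists g => // i p Up.
  by rewrite subrr; exact: dg.
have cx : continuous x := smooth_continuous x_immersion.1.
have cf : continuous f := smooth_continuous sf.
have cxij i j : continuous (fun z => x z i j).
  move=> z; apply: (@continuous_comp _ _ _ x (fun A => A i j)).
    exact: cx.
  exact: coord_continuous.
pose r z := 2^-1 * metric (x z) (x z).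
have cr : continuous r.
  have -> : r = fun z => 2^-1 * (x z 0 0 * x z 0 0 + x z 0 1 * x z 0 1 +
      (x z 1 0 * x z 1 0 + x z 1 1 * x z 1 1)).
    by apply/funext => z; rewrite /r metricE.
  apply: continuousZ_real; apply: continuousD_real; apply: continuousD_real;
    apply: continuousM_real; exact: cxij.
have [mr mrmax] := maximum_exists M_compact cr.
pose C := (1 - cos theta ^+ 2) * expR (r mr).
pose g z := expR (r z) + 2^-1 * C * (f z * f z).
have cg : continuous g.
  apply: continuousD_real; last by apply: continuousZ_real; exact: continuousM_real.
  by move=> z; exact: (continuous_comp (cr z) (@continuous_expR R _)).
have [m mmax] := maximum_exists M_compact cg.
have [i mi] := chart_cover m.
have s0 := sqr_cos_lt1 theta_range.
have im := chart_dom_cod mi.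
have ap q (k : 'I_2) : chart_cod i q ->
  let P := partial 0 (x \o param i) q in let Q := partial 1 (x \o param i) q in
  let P' := partial k (partial 0 (x \o param i)) q in
  let Q' := partial k (partial 1 (x \o param i)) q in
  (re_vol P Q ^+ 2 + im_vol P Q ^+ 2) * partial (W := R) k (f \o param i) q =
  im_vol P Q * (re_vol P' Q + re_vol P Q')
  - re_vol P Q * (im_vol P' Q + im_vol P Q').
  move=> Uq.
  have := maslov_formE x_immersion theta_range x_angle alpha_maslov k Uq.
  by rewrite df // mxE.
have rC : (1 - cos theta ^+ 2) * expR (2^-1 * metric
    ((x \o param i) (chart i m)) ((x \o param i) (chart i m))) <= C.
  by rewrite /C ler_pM2l // ler_expR /= chartK //; exact: mrmax.
apply: (no_local_maximum (@chart_cod_open _ M i) (x_immersion.1 i) (sf i)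
  (fun q Uq => chart_gram_gt0 x_immersion Uq)
  (fun q Uq => chart_kahler_angle x_immersion x_angle Uq) ap
  (fun q Uq => x_shrinker _ _ Uq) im s0 rC).
by move=> q Uq; rewrite /= (chartK mi); exact: mmax.
Qed.
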